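(* Let $V$ be a nonlocal vertex $\mathbb{Z}$-graded algebra and let $(W,Y_{W})$ be a module (resp. quasi module) for $V$ viewed as a nonlocal vertex algebra. For $v\in V$, set $$X_{W}(v,x)=Y_{W}(x^{L(0)}v,x)\in \mathrm{Hom}(W,W((x)))\subset (\mathrm{End}\,W)[[x,x^{-1}]].$$ Then $(W,X_{W})$ carries the structure of a $\phi$-coordinated module (resp. $\phi$-coordinated quasi module) with $\phi(x,z)=xe^{z}$ for the nonlocal vertex algebra $(V,Y[\cdot,x],\mathbf{1})$, where $Y[v,x]=Y(e^{xL(0)}v,e^{x}-1)$ for $v\in V$.
   Context: All vector spaces are over $\mathbb{C}$; $W((x_1,x_2))=W[[x_1,x_2]][x_1^{-1},x_2^{-1}]$. A nonlocal vertex algebra is a vector space $V$ with a linear map $Y(\cdot,x):V\to\mathrm{Hom}(V,V((x)))$, $v\mapsto Y(v,x)=\sum_{n\in\mathbb{Z}}v_nx^{-n-1}$, and a vector $\mathbf{1}\in V$ such that $Y(\mathbf{1},x)v=v$, $Y(v,x)\mathbf{1}\in V[[x]]$, $\lim_{x\to0}Y(v,x)\mathbf{1}=v$ for $v\in V$, and for $u,v,w\in V$ there exists a nonnegative integer $l$ with $(x_0+x_2)^lY(u,x_0+x_2)Y(v,x_2)w=(x_0+x_2)^lY(Y(u,x_0)v,x_2)w$ (powers of $x_0+x_2$ expanded in nonnegative powers of $x_2$). A nonlocal vertex $\mathbb{Z}$-graded algebra is a nonlocal vertex algebra $V$ with a grading $V=\bigoplus_{n\in\mathbb{Z}}V_{(n)}$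 such that $\mathbf{1}\in V_{(0)}$ and $v_nV_{(k)}\subset V_{(m+k-n-1)}$ for $v\in V_{(m)}$, $m,n,k\in\mathbb{Z}$. $L(0)$ is the linear operator with $L(0)|_{V_{(n)}}=n$, and $x^{L(0)}u=x^nu$, $e^{xL(0)}u=e^{nx}u$ for $u\in V_{(n)}$. In $Y[v,x]$, powers $(e^x-1)^m$, $m\in\mathbb{Z}$, are taken in $\mathbb{C}((x))$. A module for a nonlocal vertex algebra $V$ is a vector space $W$ with a linear map $Y_W(\cdot,x):V\to\mathrm{Hom}(W,W((x)))$ such that $Y_W(\mathbf{1},x)=1_W$ and for $u,v\in V$, $w\in W$ there exists a nonnegative integer $l$ with $(x_0+x_2)^lY_W(u,x_0+x_2)Y_W(v,x_2)w=(x_0+x_2)^lY_W(Y(u,x_0)v,x_2)w$. A quasi module is defined by replacing this last condition with: for $u,v\in V$ there exists a nonzero $q(x_1,x_2)\in\mathbb{C}[[x_1,x_2]]$ such that $q(x_1,x_2)Y_W(u,x_1)Y_W(v,x_2)\in\mathrm{Hom}(W,W((x_1,x_2)))$ and $$\left(q(x_1,x_2)Y_W(u,x_1)Y_W(v,x_2)\right)|_{x_1=x_2+x_0}=q(x_2+x_0,x_2)Y_W(Y(u,x_0)v,x_2).$$ With $\phi(x,z)=xe^z$, a $\phi$-coordinated quasi module for a nonlocal vertex algebra $(V,Y,\mathbf{1})$ is a vector space $W$ with a linear map $Y_W(\cdot,x):V\to\mathrm{Hom}(W,W((x)))$ such that $Y_W(\mathbf{1},x)=1_W$ and for $u,v\in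 V$ there exists $q(x_1,x_2)\in\mathbb{C}[[x_1,x_2]]$ such that $q(x_2e^{x_0},x_2)\neq0$, $q(x_1,x_2)Y_W(u,x_1)Y_W(v,x_2)\in\mathrm{Hom}(W,W((x_1,x_2)))$ and $$\left(q(x_1,x_2)Y_W(u,x_1)Y_W(v,x_2)\right)|_{x_1=x_2e^{x_0}}=q(x_2e^{x_0},x_2)Y_W(Y(u,x_0)v,x_2).$$ A $\phi$-coordinated module is defined in the same way with $q(x_1,x_2)$ required to be of the form $(x_1-x_2)^k$, $k$ a nonnegative integer. *)

(* Defs.v *)
From mathcomp Require Import all_boot all_order all_algebra.
From mathcomp Require Import all_classical reals.
From mathcomp Require Import complex.

Set Implicit Arguments.
Unset Strict Implicit.
Unset Printing Implicit Defensive.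

Import GRing.Theory Num.Theory.
Local Open Scope classical_set_scope.
Local Open Scope ring_scope.

(* A doubly infinite formal series in W[[x, x^-1]] is a function int -> W giving
   the coefficient of x^n at n, and one in W[[x1^+-1, x2^+-1]] is a function
   int -> int -> W giving the coefficient of x1^a x2^b (or x0^a x2^b) at a b.
   Products and substitutions are written with the finitely supported sum
   \sum_(i \in A), which is 0 when the support is infinite; the supports are
   finite wherever these operations are applied to vertex operators below,
   thanks to the truncation conditions. *)

Section Series.
Variables (F : fieldType) (W : lmodType F).

(* W((x)) *)
Definition is_laurent (f : int -> W) : Prop :=
  exists N : int, forall n, n < N -> f n = 0.

(* W((x1, x2)) = W[[x1, x2]][x1^-1, x2^-1] *)
Definition is_laurent2 (A : int -> int -> W) : Prop :=
  exists N : int, forall a b, (a < N) || (b < N) -> A a b = 0.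

(* W[[x1, x2]] *)
Definition is_power2 (A : int -> int -> W) : Prop :=
  forall a b, (a < 0) || (b < 0) -> A a b = 0.

Definition mul2 (q : int -> int -> F) (A : int -> int -> W) : int -> int -> W :=
  fun a b => \sum_(p \in [set: int * int]) q p.1 p.2 *: A (a - p.1) (b - p.2).

(* The substitution x1 = phi(x0, x2) in A(x1, x2): the series
   \sum_(m, n) A_(m, n) phi^m x2^n, where K m a c is the coefficient of
   x0^a x2^c in phi^m. *)
Definition subst1 (K : int -> int -> int -> F) (A : int -> int -> W) :
    int -> int -> W :=
  fun a b =>
    \sum_(p \in [set: int * int]) K p.1 a (b - p.2) *: A p.1 p.2.

End Series.

Section ScalarSeries.
Variable F : fieldType.

(* Polynomials in x1 = 'X and x2 = 'X%:P. *)
Definition poly2 (p : {poly {poly F}}) : int -> int -> F :=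
  fun a b => match a, b with Posz i, Posz j => p`_i`_j | _, _ => 0 end.

(* m (m - 1) ... (m - k + 1) / k! *)
Definition binz (m : int) (k : nat) : F :=
  (\prod_(i < k) (m - i%:Z)%:~R) / k`!%:R.

(* Coefficient of x0^a x2^c in (x0 + x2)^m, expanded in nonnegative powers
   of x2. *)
Definition pow_x0_x2 (m a c : int) : F :=
  match c with Posz k => (a == m - k%:Z)%:R * binz m k | Negz _ => 0 end.

(* Coefficient of x0^a x2^c in (x2 + x0)^m, expanded in nonnegative powers
   of x0. *)
Definition pow_x2_x0 (m a c : int) : F := pow_x0_x2 m c a.

(* Coefficient of x^j in e^(n x). *)
Definition exp_coef (n j : int) : F :=
  match j with Posz k => n%:~R ^+ k / k`!%:R | Negz _ => 0 end.

(* Coefficient of x0^a x2^c in (x2 e^x0)^m. *)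
Definition pow_x2_exp_x0 (m a c : int) : F := (c == m)%:R * exp_coef m a.

Definition lone : int -> F := fun n => (n == 0)%:R.

Definition lmul (f g : int -> F) : int -> F :=
  fun n => \sum_(i \in [set: int]) f i * g (n - i).

(* The inverse in the field F((x)). *)
Definition linv (f : int -> F) : int -> F :=
  xget (fun=> 0)
    [set g : int -> F | is_laurent (g : int -> F^o) /\ lmul f g = lone].

Definition lexp (f : int -> F) (m : int) : int -> F :=
  match m with
  | Posz k => iter k (lmul f) lone
  | Negz k => linv (iter k.+1 (lmul f) lone)
  end.

(* e^x - 1 *)
Definition expx_sub1 : int -> F := fun n => exp_coef 1 n - lone n.

End ScalarSeries.

(* A vertex operator map Y sends v, w to the series Y(v, x)w, so that
   Y v w n is the coefficient of x^n; the mode v_n w is vmode Y v n w. *)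
Section VertexAlgebras.
Variable F : fieldType.

Section Operators.
Variables V W : lmodType F.

Definition vmode (Y : V -> W -> int -> W) (v : V) (n : int) (w : W) : W :=
  Y v w (- n - 1).

(* Y(., x) is a linear map V -> Hom(W, W((x))). *)
Record vertex_map (Y : V -> W -> int -> W) : Prop := VertexMap {
  vertex_map_linearl : forall w n, linear (fun v => Y v w n);
  vertex_map_linearr : forall v n, linear (fun w => Y v w n);
  vertex_map_laurent : forall v w, is_laurent (Y v w)
}.

(* Y(u, x1) Y(v, x2) w *)
Definition op_prod (Y : V -> W -> int -> W) (u v : V) (w : W) :
    int -> int -> W :=
  fun a b => Y u (Y v w b) a.

(* Y_W(Y(u, x0)v, x2) w *)
Definition op_iter (Y : V -> V -> int -> V) (YW : V -> W -> int -> W)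
    (u v : V) (w : W) : int -> int -> W :=
  fun a b => YW (Y u v a) w b.

(* (x0 + x2)^l Y_W(u, x0 + x2) Y_W(v, x2) w
     = (x0 + x2)^l Y_W(Y(u, x0)v, x2) w for some l *)
Definition weak_assoc (Y : V -> V -> int -> V) (YW : V -> W -> int -> W) :
    Prop :=
  forall u v w, exists l : nat,
    mul2 (poly2 (('X + 'X%:P) ^+ l)) (subst1 (@pow_x0_x2 F) (op_prod YW u v w))
    = mul2 (poly2 (('X + 'X%:P) ^+ l)) (op_iter Y YW u v w).

(* q(x1, x2) Y_W(u, x1) Y_W(v, x2) lies in Hom(W, W((x1, x2))), and its
   image under the substitution x1 = phi(x0, x2) encoded by K is
   q(phi(x0, x2), x2) Y_W(Y(u, x0)v, x2). *)
Definition subst_compat (K : int -> int -> int -> F)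
    (Y : V -> V -> int -> V) (YW : V -> W -> int -> W)
    (q : int -> int -> F) (u v : V) : Prop :=
  (forall w, is_laurent2 (mul2 q (op_prod YW u v w))) /\
  (forall w, subst1 K (mul2 q (op_prod YW u v w))
             = mul2 (subst1 K (q : int -> int -> F^o)) (op_iter Y YW u v w)).

End Operators.

Section Algebras.
Variable V : lmodType F.

Record nonlocal_vertex_algebra (Y : V -> V -> int -> V) (vac : V) : Prop :=
  NonlocalVertexAlgebra {
  nva_vertex_map : vertex_map Y;
  nva_vacuum : forall v n, Y vac v n = if n == 0 then v else 0;
  nva_creation : forall v n, n < 0 -> Y v vac n = 0;
  nva_creation_lim : forall v, Y v vac 0 = v;
  nva_weak_assoc : weak_assoc Y Y
}.

(* c lists the homogeneous components of v. *)
Definition homog_decomp (gr : int -> {pred V}) (v : V) (c : int -> V) : Prop :=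
  [/\ forall n, c n \in gr n,
      finite_set [set n | c n != 0]
    & v = \sum_(n \in [set: int]) c n].

(* V is the direct sum of its subspaces gr n. *)
Definition direct_sum_grading (gr : int -> {pred V}) : Prop :=
  (forall n, submod_closed (gr n)) /\
  (forall v, exists! c : int -> V, homog_decomp gr v c).

Definition homog_comp (gr : int -> {pred V}) (v : V) : int -> V :=
  xget (fun=> 0) [set c : int -> V | homog_decomp gr v c].

Record nonlocal_vertex_Zgraded_algebra
    (gr : int -> {pred V}) (Y : V -> V -> int -> V) (vac : V) : Prop :=
  NonlocalVertexZGradedAlgebra {
  nvZa_nva : nonlocal_vertex_algebra Y vac;
  nvZa_grading : direct_sum_grading gr;
  nvZa_vacuum : vac \in gr 0;
  nvZa_mode : forall (m n k : int) (v u : V), v \in gr m -> u \in gr k ->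
    vmode Y v n u \in gr (m + k - n - 1)
}.

(* x^L(0) v, with L(0) = n on gr n: the coefficient of x^n is the component
   of v in gr n. *)
Definition x_pow_L0 (gr : int -> {pred V}) (v : V) : int -> V :=
  homog_comp gr v.

(* e^(x L(0)) v = \sum_n e^(n x) v_(n), with v_(n) the component of v
   in gr n. *)
Definition exp_x_L0 (gr : int -> {pred V}) (v : V) : int -> V :=
  fun j => \sum_(n \in [set: int]) exp_coef F n j *: homog_comp gr v n.

(* Y[v, x]w = Y(e^(x L(0)) v, e^x - 1) w, that is, the sum over j, m of
   x^j (e^x - 1)^m times the coefficient of z^m in Y(v', z)w, where v' is the
   coefficient of x^j in e^(x L(0)) v. *)
Definition Ybracket (gr : int -> {pred V}) (Y : V -> V -> int -> V) :
    V -> V -> int -> V :=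
  fun v w k => \sum_(p \in [set: int * int])
    lexp (@expx_sub1 F) p.2 (k - p.1) *: Y (exp_x_L0 gr v p.1) w p.2.

End Algebras.

Section Modules.
Variables V W : lmodType F.

(* X_W(v, x)w = Y_W(x^L(0) v, x) w *)
Definition XW (gr : int -> {pred V}) (YW : V -> W -> int -> W) :
    V -> W -> int -> W :=
  fun v w k => \sum_(j \in [set: int]) YW (x_pow_L0 gr v j) w (k - j).

(* The structures below are meant for (Y, vac) a nonlocal vertex algebra
   on V. *)

Record is_module (Y : V -> V -> int -> V) (vac : V)
    (YW : V -> W -> int -> W) : Prop := IsModule {
  mod_vertex_map : vertex_map YW;
  mod_vacuum : forall w n, YW vac w n = if n == 0 then w else 0;
  mod_weak_assoc : weak_assoc Y YW
}.

Record is_quasi_module (Y : V -> V -> int -> V) (vac : V)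
    (YW : V -> W -> int -> W) : Prop := IsQuasiModule {
  qmod_vertex_map : vertex_map YW;
  qmod_vacuum : forall w n, YW vac w n = if n == 0 then w else 0;
  qmod_assoc : forall u v, exists q : int -> int -> F,
    [/\ is_power2 (q : int -> int -> F^o),
        q <> (fun _ _ => 0)
      & subst_compat (@pow_x2_x0 F) Y YW q u v]
}.

(* phi-coordinated (quasi) modules, phi(x, z) = x e^z; q_ok is the form
   required of q. *)
Record is_phi_coordinated_for (q_ok : (int -> int -> F) -> Prop)
    (Y : V -> V -> int -> V) (vac : V) (YW : V -> W -> int -> W) : Prop :=
  IsPhiCoordinatedFor {
  phi_vertex_map : vertex_map YW;
  phi_vacuum : forall w n, YW vac w n = if n == 0 then w else 0;
  phi_assoc : forall u v, exists q : int -> int -> F,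
    [/\ q_ok q,
        subst1 (@pow_x2_exp_x0 F) (q : int -> int -> F^o) <> (fun _ _ => 0)
      & subst_compat (@pow_x2_exp_x0 F) Y YW q u v]
}.

Definition is_phi_coordinated_quasi_module :=
  is_phi_coordinated_for (fun q => is_power2 (q : int -> int -> F^o)).

Definition is_phi_coordinated_module :=
  is_phi_coordinated_for
    (fun q => exists k : nat, q = poly2 (('X - 'X%:P) ^+ k)).

End Modules.

End VertexAlgebras.

(* Main.v *)
(* A substitution is the linear operator on series given by the matrix of the
   images of the monomials, so that identities between composed substitutions
   need only be checked on monomials; since the images of x^i obey the exponent
   law, this reduces further to i = 1.  For homogeneous u, v of weights m, n, put
   P = Y_W(u, x1) Y_W(v, x2) w and I = Y_W(Y(u, x0) v, x2) w.

   Quasi modules: substituting x0 = x2 (e^z - 1) in the identity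
   (q P)(x2 + x0, x2) = q(x2 + x0, x2) I turns x2 + x0 into x2 e^z, and
   e^(m z) x2^(m + n) I into X_W(Y[u, z] v, x2) w, because the component
   Y(u, x0) v at x0^i has weight m + n + i.  Non-homogeneous u, v are sums of
   homogeneous vectors, for which the factors q are multiplied together.

   Modules: let k be such that x0^k Y(u, x0) v has no negative powers of x0; it
   depends on u, v only.  By weak associativity x0^k (x0 + x2)^l I has
   nonnegative powers of x0 and powers of x2 bounded below, so that x0 = x1 - x2
   can be substituted in it, which gives (x1 - x2)^k x1^l P.  Hence
   q = (x1 - x2)^k works for every w.

   Algebra: substitute x0 -> e^x2 (e^x0 - 1), x2 -> e^x2 - 1 in weak
   associativity.  Then x0 + x2 becomes e^(x0 + x2) - 1, and the resulting factor
   (e^(x0 + x2) - 1)^l is turned into (x0 + x2)^l by multiplying by the power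
   series (x / (e^x - 1))^l at x = x0 + x2. *)

Require Import Defs.
From mathcomp Require Import all_boot all_order all_algebra.
From mathcomp Require Import finmap all_classical reals.
From mathcomp Require Import complex zify ring.

Set Implicit Arguments.
Unset Strict Implicit.
Unset Printing Implicit Defensive.

Import Order.TTheory GRing.Theory Num.Theory.
Local Open Scope classical_set_scope.
Local Open Scope ring_scope.

(** * Finitely supported sums over arbitrary index types *)

Section FiniteSums.
Variable W : zmodType.

(** Any finite set containing the support may serve as the range of summation, so that several sums
    can be compared over one common set. *)
Lemma fsum_fset (I : choiceType) (S : set I) (f : I -> W) : finite_set S ->
    (forall i, f i <> 0 -> S i) ->
  \sum_(i \in [set: I]) f i = \sum_(i <- fset_set S) f i.
Proof.
move=> finS fS; apply: fsbigTE => i; apply: contraNeq => /eqP/fS Si.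
by rewrite in_fset_set// inE.
Qed.

Lemma fsum_neq0 (I : choiceType) (f : I -> W) :
  \sum_(i \in [set: I]) f i <> 0 -> exists i, f i <> 0.
Proof.
by move=> f0; apply/not_existsP => f1; apply: f0; apply: fsbig1 => i _;
  apply/not_notP/f1.
Qed.

(** Finiteness of the joint support controls the outer sum and all inner sums at once, through the
    two projections of that support. *)
Lemma fsum_pair (I J : choiceType) (f : I -> J -> W) :
    finite_set [set p : I * J | f p.1 p.2 <> 0] ->
  \sum_(i \in [set: I]) \sum_(j \in [set: J]) f i j
  = \sum_(p \in [set: I * J]) f p.1 p.2.
Proof.
set D := [set p | _] => finD.
have finA : finite_set (fst @` D) by exact: finite_image.
have finB : finite_set (snd @` D) by exact: finite_image.
have sumJ i : \sum_(j \in [set: J]) f i j = \sum_(j <- fset_set (snd @` D)) f i j.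
  by apply: fsum_fset => // j fij; exists (i, j).
rewrite (@fsum_fset _ (fst @` D))//; last first.
  by move=> i /fsum_neq0[j fij]; exists (i, j).
rewrite (@fsum_fset _ ((fst @` D) `*` (snd @` D))) /=; last 2 first.
- exact: finite_setX.
- by move=> [i j] fij; split; exists (i, j).
rewrite -(@fsum_fset _ _ (fun p => f p.1 p.2)) /=; last 2 first.
- exact: finite_setX.
- by move=> [i j] fij; split; exists (i, j).
under eq_bigr do rewrite sumJ.
rewrite [RHS](_ : _ = \sum_(p \in (fst @` D) `*` (snd @` D)) f p.1 p.2); last first.
  apply/esym/fsbig_widen => // -[i j] [_ /= nD]; apply/not_notP => fij.
  by apply: nD; split; exists (i, j).
rewrite -(@pair_fsbig _ _ _ I J _ _ f)// fsbig_finite//; apply: eq_bigr => i _.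
by rewrite fsbig_finite.
Qed.

Lemma fsum_exchange (I J : choiceType) (f : I -> J -> W) :
    finite_set [set p : I * J | f p.1 p.2 <> 0] ->
  \sum_(i \in [set: I]) \sum_(j \in [set: J]) f i j
  = \sum_(j \in [set: J]) \sum_(i \in [set: I]) f i j.
Proof.
move=> finD; rewrite fsum_pair// (@fsum_pair _ _ (fun j i => f i j)) /=.
  rewrite [LHS](reindex_fsbigT (fun p : J * I => (p.2, p.1)))//.
  by exists (fun p : I * J => (p.2, p.1)) => -[].
have -> : [set p : J * I | f p.2 p.1 <> 0]
    = (fun p : I * J => (p.2, p.1)) @` [set p : I * J | f p.1 p.2 <> 0].
  apply/seteqP; split=> [[j i]/= fij|_ [[i j]/= fij <-]//].
  by exists (i, j).
exact: finite_image.
Qed.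

Lemma fsum_single (I : choiceType) (i0 : I) (f : I -> W) :
  (forall i, f i <> 0 -> i = i0) -> \sum_(i \in [set: I]) f i = f i0.
Proof.
move=> fi; rewrite (@fsum_fset _ [set i0])//; first by rewrite fset_set1 big_seq_fset1.
Qed.

Lemma fsumD (I : choiceType) (f g : I -> W) :
    finite_set [set i | f i <> 0] -> finite_set [set i | g i <> 0] ->
  \sum_(i \in [set: I]) (f i + g i)
  = \sum_(i \in [set: I]) f i + \sum_(i \in [set: I]) g i.
Proof.
move=> finf fing; pose S := [set i | f i <> 0] `|` [set i | g i <> 0].
have finS : finite_set S by rewrite finite_setU.
rewrite !(@fsum_fset _ S)//.
- by rewrite big_split.
- by move=> i; right.
- by move=> i; left.
move=> i fgi; apply/not_notP => /not_orP[/contrapT fi /contrapT gi]; apply: fgi.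
by rewrite fi gi addr0.
Qed.

End FiniteSums.

Section FiniteSumsScale.
Variables (F : fieldType) (W : lmodType F).

(** For [a] nonzero both families have the same support, so the two sums are either both finite or
    both equal to the default value 0. *)
Lemma fsum_scaler (I : choiceType) (a : F) (f : I -> W) :
  a *: \sum_(i \in [set: I]) f i = \sum_(i \in [set: I]) a *: f i.
Proof.
have [->|a0] := eqVneq a 0.
  by rewrite scale0r fsbig1// => i _; rewrite scale0r.
have E : [set i | a *: f i <> 0] = [set i | f i <> 0].
  apply/seteqP; split=> i /=; first by apply: contra_not => ->; rewrite scaler0.
  by apply: contra_not => /eqP; rewrite scaler_eq0 (negPf a0) => /eqP.
case: (pselect (finite_set [set i | f i <> 0])) => finf.
  rewrite !(@fsum_fset _ _ [set i | f i <> 0])// ?scaler_sumr//; last by rewrite -E.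
by rewrite !fsbig_dflt ?scaler0 ?setTI//; move: finf; rewrite -E.
Qed.

Lemma fsum_scalel (I : choiceType) (f : I -> F) (w : W) :
  (\sum_(i \in [set: I]) f i) *: w = \sum_(i \in [set: I]) f i *: w.
Proof.
have [->|w0] := eqVneq w 0.
  by rewrite scaler0 fsbig1// => i _; rewrite scaler0.
have E : [set i | f i *: w <> 0] = [set i | f i <> 0].
  apply/seteqP; split=> i /=; first by apply: contra_not => ->; rewrite scale0r.
  by apply: contra_not => /eqP; rewrite scaler_eq0 (negPf w0) orbF => /eqP.
case: (pselect (finite_set [set i | f i <> 0])) => finf.
  rewrite !(@fsum_fset _ _ [set i | f i <> 0])// ?scaler_suml//; last by rewrite -E.
by rewrite !fsbig_dflt ?scale0r ?setTI//; move: finf; rewrite -E.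
Qed.

End FiniteSumsScale.

(** * Infinite matrices and convolution products acting on vector-valued series *)

Section Matrices.
Variables (F : fieldType) (W : lmodType F).

(** Row [M i] holds the coefficients of the image of the monomial of exponent [i], so [app M] is a
    substitution. The index types stay general in order to treat one and two variables alike. *)
Definition app (I J : choiceType) (M : I -> J -> F) (A : I -> W) : J -> W :=
  fun j => \sum_(i \in [set: I]) M i j *: A i.

Definition conv (I : zmodType) (q : I -> F) (A : I -> W) : I -> W :=
  fun k => \sum_(p \in [set: I]) q p *: A (k - p).

Lemma app_neq0 (I J : choiceType) (M : I -> J -> F) (A : I -> W) j :
  app M A j <> 0 -> exists i, M i j <> 0 /\ A i <> 0.
Proof.
move=> /fsum_neq0[i MA]; exists i; split; apply: contra_not MA => ->.
  by rewrite scale0r.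
by rewrite scaler0.
Qed.

Lemma conv_neq0 (I : zmodType) (q : I -> F) (A : I -> W) k :
  conv q A k <> 0 -> exists p, q p <> 0 /\ A (k - p) <> 0.
Proof.
move=> /fsum_neq0[i MA]; exists i; split; apply: contra_not MA => ->.
  by rewrite scale0r.
by rewrite scaler0.
Qed.

Lemma scale_neq0 (a : F) (w : W) : a *: w <> 0 -> a <> 0 /\ w <> 0.
Proof.
by move=> aw; split; apply: contra_not aw => ->; rewrite ?scale0r ?scaler0.
Qed.

End Matrices.

Lemma mul_neq0 (F : fieldType) (a b : F) : a * b <> 0 -> a <> 0 /\ b <> 0.
Proof.
by move=> ab; split; apply: contra_not ab => ->; rewrite ?mul0r ?mulr0.
Qed.

Section MatrixTheory.
Variable F : fieldType.

(** Scalar series are vector-valued series in the module [F^o], so [cmul] and [capp] inherit the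
    results proved for modules. *)
Definition cmul (I : zmodType) (q q' : I -> F) : I -> F :=
  conv q (q' : I -> F^o).

Definition capp (I J : choiceType) (M : I -> J -> F) (q : I -> F) : J -> F :=
  app M (q : I -> F^o).

Lemma cmul_neq0 (I : zmodType) (q q' : I -> F) k :
  cmul q q' k <> 0 -> exists p, q p <> 0 /\ q' (k - p) <> 0.
Proof. exact: (@conv_neq0 F F^o). Qed.

Lemma capp_neq0 (I J : choiceType) (M : I -> J -> F) (q : I -> F) j :
  capp M q j <> 0 -> exists i, M i j <> 0 /\ q i <> 0.
Proof. exact: (@app_neq0 F F^o). Qed.

Section Module.
Variable W : lmodType F.

(** The set required to be finite is the joint support of the double sum at the output index [k]; it
    licenses the exchange of the two summations. *)
Lemma app_app (I J K : choiceType) (M : I -> J -> F) (M' : J -> K -> F)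
    (A : I -> W) k :
    finite_set [set p : I * J | [/\ A p.1 <> 0, M p.1 p.2 <> 0 & M' p.2 k <> 0]] ->
  app M' (app M A) k = app (fun i => capp M' (M i)) A k.
Proof.
move=> fin; rewrite /app.
under eq_fsbigr do rewrite fsum_scaler.
rewrite (@fsum_exchange _ _ _ (fun j i => M' j k *: (M i j *: A i))); last first.
  apply: sub_finite_set (finite_image (fun p : I * J => (p.2, p.1)) fin).
  move=> [j i] /= /scale_neq0[M'0 /scale_neq0[M0 A0]].
  by exists (i, j).
apply: eq_fsbigr => i _; rewrite /capp /app fsum_scalel.
by apply: eq_fsbigr => j _; rewrite scalerA.
Qed.

Lemma convA (I : zmodType) (q q' : I -> F) (A : I -> W) k :
    finite_set [set p : I * I | [/\ q p.1 <> 0, q' p.2 <> 0 & A (k - p.1 - p.2) <> 0]] ->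
  conv q (conv q' A) k = conv (cmul q q') A k.
Proof.
move=> fin; rewrite /conv.
under eq_fsbigr do rewrite fsum_scaler.
(* The inner sum is reindexed by the total exponent [s] of the two scalar factors. *)
transitivity (\sum_(p \in [set: I]) \sum_(s \in [set: I])
    (q p * q' (s - p)) *: A (k - s)).
  apply: eq_fsbigr => p _; rewrite [LHS](reindex_fsbigT (fun s => s - p)).
    by apply: eq_fsbigr => s _; rewrite scalerA opprB addrA addrNK.
  by exists (fun s => s + p) => s; rewrite (addrK, addrNK).
rewrite fsum_exchange.
  apply: eq_fsbigr => s _; rewrite -fsum_scalel; congr (_ *: _).
apply: sub_finite_set (finite_image (fun p : I * I => (p.1, p.2 + p.1)) fin).
move=> [p s] /= /scale_neq0[/mul_neq0[q0 q'0] A0].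
exists (p, s - p) => /=; last by rewrite addrNK.
by split=> //; rewrite opprB addrA addrNK.
Qed.

(* A substitution Phi, semilinear over a substitution Psi of scalar series, is
   compatible with products. *)
Lemma app_conv (I J : zmodType) (Phi Psi : I -> J -> F) (q : I -> F) (A : I -> W) k :
    (forall p r, Phi (p + r) = cmul (Psi p) (Phi r)) ->
    finite_set [set t : (I * I) * J | [/\ q t.1.1 <> 0, A t.1.2 <> 0,
      Psi t.1.1 t.2 <> 0 & Phi t.1.2 (k - t.2) <> 0]] ->
  app Phi (conv q A) k = conv (capp Psi q) (app Phi A) k.
Proof.
move=> mulP fin; rewrite /conv /app.
(* The terms of the triple sum: exponents r, s taken from [q] and [A], and the part [j] of the
   output exponent that comes from the image of [q]. *)
pose f (rs : I * I) (j : J) :=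
  (q rs.1 * (Psi rs.1 j * Phi rs.2 (k - j))) *: A rs.2.
have f0 rs j : f rs j <> 0 -> [/\ q rs.1 <> 0, A rs.2 <> 0,
    Psi rs.1 j <> 0 & Phi rs.2 (k - j) <> 0].
  by move=> /scale_neq0[/mul_neq0[q0 /mul_neq0[Psi0 Phi0]] A0].
have finf : finite_set [set p | f p.1 p.2 <> 0].
  by apply: sub_finite_set fin => -[rs j] /f0.
have PhiE r s : (Phi (r + s) k * q r) *: A s = \sum_(j \in [set: J]) f (r, s) j.
  rewrite mulP mulrC -scalerA fsum_scalel fsum_scaler.
  by apply: eq_fsbigr => j _; rewrite scalerA.
have fin2 : finite_set [set p : I * I | (Phi (p.1 + p.2) k * q p.1) *: A p.2 <> 0].
  apply: sub_finite_set (finite_image fst finf) => -[r s] /=.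
  by rewrite PhiE => /fsum_neq0[j fj]; exists ((r, s), j).
(* The left side becomes a sum over pairs (r, s), the exponent of the product being r + s; [PhiE]
   then expands each term over [j]. *)
transitivity (\sum_(rs \in [set: I * I]) (Phi (rs.1 + rs.2) k * q rs.1) *: A rs.2).
  under eq_fsbigr do rewrite fsum_scaler.
  rewrite fsum_exchange; last first.
    apply: sub_finite_set (finite_image (fun p : I * I => (p.1 + p.2, p.1)) fin2).
    move=> [p r] /= h; exists (r, p - r) => /=; last by rewrite addrC subrK.
    by rewrite addrC subrK -scalerA.
  rewrite -(@fsum_pair _ _ _ (fun r s => (Phi (r + s) k * q r) *: A s) fin2).
  apply: eq_fsbigr => r _.
  rewrite [LHS](reindex_fsbigT (fun s => r + s)).
    by apply: eq_fsbigr => s _; rewrite scalerA addrAC subrr add0r.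
  by exists (fun s => - r + s) => s; rewrite (addKr, addNKr).
transitivity (\sum_(j \in [set: J]) \sum_(rs \in [set: I * I]) f rs j).
  by rewrite -fsum_exchange//; apply: eq_fsbigr => -[r s] _; rewrite PhiE.
apply: eq_fsbigr => j _; rewrite fsum_scalel.
have finj : finite_set [set p | f p j <> 0].
  apply: sub_finite_set (finite_image fst finf) => rs fj.
  by exists (rs, j).
have finj' : finite_set [set p : I * I | f (p.1, p.2) j <> 0].
  by apply: sub_finite_set finj => -[r s].
transitivity (\sum_(r \in [set: I]) \sum_(s \in [set: I]) f (r, s) j).
  by rewrite (fsum_pair finj'); apply: eq_fsbigr => -[].
apply: eq_fsbigr => r _; rewrite fsum_scaler; apply: eq_fsbigr => s _.
by rewrite /f /= !scalerA; congr (_ *: _);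
  rewrite -[LHS]/(q r * (Psi r j * Phi s (k - j)))
    -[RHS]/(Psi r j * q r * Phi s (k - j)); ring.
Qed.

End Module.

Lemma cmulA (I : zmodType) (q q' A : I -> F) k :
    finite_set [set p : I * I | [/\ q p.1 <> 0, q' p.2 <> 0 & A (k - p.1 - p.2) <> 0]] ->
  cmul q (cmul q' A) k = cmul (cmul q q') A k.
Proof. exact: (@convA F^o _ q q' A). Qed.

Lemma capp_cmul (I J : zmodType) (Phi Psi : I -> J -> F) (q A : I -> F) k :
    (forall p r, Phi (p + r) = cmul (Psi p) (Phi r)) ->
    finite_set [set t : (I * I) * J | [/\ q t.1.1 <> 0, A t.1.2 <> 0,
      Psi t.1.1 t.2 <> 0 & Phi t.1.2 (k - t.2) <> 0]] ->
  capp Phi (cmul q A) k = cmul (capp Psi q) (capp Phi A) k.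
Proof. exact: (@app_conv F^o _ _ _ _ q (A : I -> F^o)). Qed.

Lemma cmulC (I : zmodType) (q q' : I -> F) : cmul q q' = cmul q' q.
Proof.
apply/funext => k; rewrite /cmul /conv [LHS](reindex_fsbigT (fun p => k - p)).
  by apply: eq_fsbigr => p _; rewrite subKr; exact: mulrC.
by exists (fun p => k - p) => p; rewrite subKr.
Qed.

(** Read as a series, this is the monomial of exponent [p]; multiplying by it shifts exponents. *)
Definition delta (I : choiceType) (p : I) : I -> F := fun r => (r == p)%:R.

Lemma app_delta (I J : choiceType) (M : I -> J -> F) p : capp M (delta p) = M p.
Proof.
apply/funext => j; rewrite /capp /app (fsum_single (i0 := p)) /delta.
  by rewrite eqxx; exact: mulr1.
move=> i; case: eqVneq => // _; rewrite -[_ *: _]/(_ * _) mulr0.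
by [].
Qed.

Section Module2.
Variable W : lmodType F.

Lemma conv_delta (I : zmodType) (p : I) (A : I -> W) k :
  conv (delta p) A k = A (k - p).
Proof.
rewrite /conv (fsum_single (i0 := p)) /delta ?eqxx ?scale1r// => i.
by case: eqVneq => // _; rewrite scale0r.
Qed.

Lemma convDr (I : zmodType) (q : I -> F) (A B : I -> W) k :
    finite_set [set p | q p <> 0 /\ A (k - p) <> 0] ->
    finite_set [set p | q p <> 0 /\ B (k - p) <> 0] ->
  conv q (fun p => A p + B p) k = conv q A k + conv q B k.
Proof.
move=> finA finB; rewrite /conv -fsumD.
- by apply: eq_fsbigr => p _; rewrite scalerDr.
- by apply: sub_finite_set finA => p /scale_neq0.
- by apply: sub_finite_set finB => p /scale_neq0.
Qed.

Lemma appD (I J : choiceType) (M : I -> J -> F) (A B : I -> W) k :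
    finite_set [set p | M p k <> 0 /\ A p <> 0] ->
    finite_set [set p | M p k <> 0 /\ B p <> 0] ->
  app M (fun p => A p + B p) k = app M A k + app M B k.
Proof.
move=> finA finB; rewrite /app -fsumD.
- by apply: eq_fsbigr => p _; rewrite scalerDr.
- by apply: sub_finite_set finA => p /scale_neq0.
- by apply: sub_finite_set finB => p /scale_neq0.
Qed.

End Module2.

End MatrixTheory.

(** * Finiteness of bounded sets of exponents *)

Lemma finite_int (B : int) (S : set int) :
  (forall x, S x -> (- B <= x) && (x <= B)) -> finite_set S.
Proof.
move=> SB;
  apply: (@sub_finite_set _ _ ((fun k : nat => k%:Z - B) @` `I_(absz B + absz B).+1)).
  move=> x /SB xB; exists (absz (x + B)) => /=; lia.
exact/finite_image/finite_II.
Qed.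

Definition bounded (B x : int) := (- B <= x) && (x <= B).

Lemma finite_int2 (B : int) (S : set (int * int)) :
  (forall p, S p -> bounded B p.1 && bounded B p.2) -> finite_set S.
Proof.
move=> SB; have fB : finite_set [set x | bounded B x] by apply: (@finite_int B).
by apply: sub_finite_set (finite_setX fB fB) => p /SB/andP[].
Qed.

Lemma finite_int4 (B : int) (S : set ((int * int) * (int * int))) :
  (forall p, S p -> [&& bounded B p.1.1, bounded B p.1.2,
                       bounded B p.2.1 & bounded B p.2.2]) -> finite_set S.
Proof.
move=> SB.
have fB : finite_set [set p : int * int | bounded B p.1 && bounded B p.2].
  exact: (@finite_int2 B).
by apply: sub_finite_set (finite_setX fB fB) => p /SB/and4P[? ? ? ?]; split; apply/andP.
Qed.

Lemma finite_int3 (B : int) (S : set ((int * int) * int)) :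
  (forall p, S p -> [&& bounded B p.1.1, bounded B p.1.2 & bounded B p.2]) ->
  finite_set S.
Proof.
move=> SB.
have fB : finite_set [set p : int * int | bounded B p.1 && bounded B p.2].
  exact: (@finite_int2 B).
have fB1 : finite_set [set x | bounded B x] by apply: (@finite_int B).
by apply: sub_finite_set (finite_setX fB fB1) => p /SB/and3P[? ? ?]; split=> //;
  apply/andP.
Qed.

Lemma finite_int6 (B : int) (S : set (((int * int) * (int * int)) * (int * int))) :
  (forall p, S p -> [&& bounded B p.1.1.1, bounded B p.1.1.2,
     bounded B p.1.2.1, bounded B p.1.2.2, bounded B p.2.1 & bounded B p.2.2]) ->
  finite_set S.
Proof.
move=> SB.
have fB : finite_set [set p : int * int | bounded B p.1 && bounded B p.2].
  exact: (@finite_int2 B).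
apply: sub_finite_set (finite_setX (finite_setX fB fB) fB) => p /SB.
by case/and5P=> ? ? ? ? /andP[? ?]; split; [split|]; apply/andP.
Qed.

(** * Families indexed by the integers that obey an exponent law *)

Section ExponentFamilies.
Variables (T : Type) (P : T -> Prop) (m : T -> T -> T) (e : T).
Hypothesis mC : forall x y, m x y = m y x.
Hypothesis mA : forall x y z, P x -> P y -> P z -> m x (m y z) = m (m x y) z.
Hypothesis m1 : forall x, m e x = x.

(** The class [P] is a domain on which the product [m] is associative, such as the Laurent series.
    Nonnegative [j] goes by induction; for j = -k one writes f i = f (i - k) f k and cancels f k
    against f (-k). *)
Lemma family_add (f : int -> T) (c : T) : P c -> (forall i, P (f i)) ->
    f 0 = e -> (forall i, f (i + 1) = m c (f i)) ->
  forall i j, f (i + j) = m (f i) (f j).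
Proof.
move=> Pc Pf f0 fS.
have pos i (n : nat) : f (i + n%:Z) = m (f i) (f n%:Z).
  elim: n => [|n IHn]; first by rewrite addr0 f0 mC m1.
  rewrite -addn1 PoszD addrA !fS IHn mA// (mC c) -mA//.
move=> i [n|n]; first exact: pos.
rewrite NegzE; set k := n.+1; have Ei : f i = m (f (i - k%:Z)) (f k%:Z).
  by rewrite -pos subrK.
rewrite [in RHS]Ei -mA// [m (f k%:Z) _]mC -pos addNr f0 mC m1//.
Qed.

(* At negative exponents, f (- k) = f (- k) f' k f' (- k) = f (- k) f k f' (- k). *)
Lemma family_eq (f f' : int -> T) (c : T) : P c -> (forall i, P (f i)) ->
    (forall i, P (f' i)) -> f 0 = e -> f' 0 = e ->
    (forall i, f (i + 1) = m c (f i)) -> (forall i, f' (i + 1) = m c (f' i)) ->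
  forall i, f i = f' i.
Proof.
move=> Pc Pf Pf' f0 f'0 fS f'S.
have pos (n : nat) : f n%:Z = f' n%:Z.
  elim: n => [|n IHn]; first by rewrite f0 f'0.
  by rewrite -addn1 PoszD fS f'S IHn.
case=> [n|n]; first exact: pos.
rewrite NegzE; set k := n.+1.
have A := family_add Pc Pf f0 fS; have A' := family_add Pc Pf' f'0 f'S.
rewrite -[LHS]m1 mC -f'0 -[0](addrN k%:Z) A' mA// -pos -A addNr f0 m1//.
Qed.

End ExponentFamilies.

(** * Laurent series in one variable: exponentials, powers of e^x - 1, binomial series *)

Section OneVariable.
Variable F : numFieldType.
Implicit Types f g h : int -> F.

Definition laur f := exists N : int, forall n, f n <> 0 -> N <= n.

Lemma is_laurentP (W : lmodType F) (f : int -> W) :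
  is_laurent f <-> exists N : int, forall n, f n <> 0 -> N <= n.
Proof.
split=> -[N fN]; exists N => n.
  by move=> fn; rewrite leNgt; apply/negP => /fN.
by move=> nN; apply/not_notP => /fN; rewrite leNgt nN.
Qed.

Lemma laur_cmul f g : laur f -> laur g -> laur (cmul f g).
Proof.
move=> [N fN] [M gM]; exists (N + M) => n /cmul_neq0[p [/fN ? /gM]]; lia.
Qed.

Lemma laur_cmulA f g h : laur f -> laur g -> laur h ->
  cmul f (cmul g h) = cmul (cmul f g) h.
Proof.
move=> [N fN] [M gM] [L hL]; apply/funext => k; rewrite cmulA//.
apply: (@finite_int2 (`|N| + `|M| + `|L| + `|k|)) => -[p q] /= [/fN ? /gM ? /hL ?].
by rewrite /bounded; lia.
Qed.

Lemma cmul1 f : cmul (@lone F) f = f.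
Proof. by apply/funext => k; rewrite [LHS](@conv_delta F F^o int 0 f) subr0. Qed.

Lemma laur_delta (d : int) : laur (@delta F _ d).
Proof. by exists d => n; rewrite /delta; case: eqVneq => // -> _. Qed.

Lemma laur_lone : laur (@lone F).
Proof. exact: laur_delta. Qed.

Definition psupp f := forall n : int, f n <> 0 -> 0 <= n.

Lemma psupp_laur f : psupp f -> laur f.
Proof. by move=> fP; exists 0. Qed.

(** Passing to sums over ordinals gives access to the binomial theorem and to inductions on the last
    term. *)
Lemma cmul_nat f g (k : nat) : psupp f -> psupp g ->
  cmul f g k%:Z = \sum_(i < k.+1) f i%:Z * g (k - i)%N%:Z.
Proof.
move=> f0 g0; rewrite /cmul /conv.
rewrite (@fsum_fset _ _ ((fun i : nat => i%:Z) @` `I_k.+1)); last 2 first.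
- exact/finite_image/finite_II.
- move=> i /scale_neq0[/f0 ? /g0 ?]; exists (absz i) => /=; lia.
rewrite -fsbig_finite; last exact/finite_image/finite_II.
rewrite fsbig_image; last by move=> i j _ _ [].
rewrite -(@fsbig_ord _ _ _ k.+1 (fun i => f i%:Z *: (g : int -> F^o) (k%:Z - i%:Z))).
by apply: eq_bigr => i _; rewrite subzn// -ltnS.
Qed.

Lemma psupp_cmul f g : psupp f -> psupp g -> psupp (cmul f g).
Proof. by move=> fN gM n /cmul_neq0[p [/fN ? /gM]]; lia. Qed.

Lemma psupp_eq f g : psupp f -> psupp g -> (forall k : nat, f k%:Z = g k%:Z) -> f = g.
Proof.
move=> fP gP fg; apply/funext => -[k|k]; first exact: fg.
have -> : f (Negz k) = 0 by apply/not_notP => /fP.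
by apply/esym/not_notP => /gP.
Qed.

(* Coefficients 0, ..., n of the inverse of a power series with constant term 1. *)
Fixpoint inv_seq f (n : nat) : seq F :=
  if n is n'.+1 then
    let s := inv_seq f n' in
    rcons s (- \sum_(i < n'.+1) f (n'.+1 - i)%N%:Z * s`_i)
  else [:: 1].

Lemma size_inv_seq f n : size (inv_seq f n) = n.+1.
Proof. by elim: n => //= n IHn; rewrite size_rcons IHn. Qed.

Lemma nth_inv_seq f n i : (i <= n)%N -> (inv_seq f n)`_i = (inv_seq f i)`_i.
Proof.
elim: n => [|n IHn]; first by rewrite leqn0 => /eqP ->.
rewrite leq_eqVlt => /predU1P[-> //|]; rewrite ltnS => le_in /=.
by rewrite nth_rcons size_inv_seq ltnS le_in IHn.
Qed.

Lemma psupp_inv f : psupp f -> f 0 = 1 ->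
  exists2 g, psupp g & cmul f g = @lone F.
Proof.
move=> fP f0.
pose g (n : int) := if n is Posz k then (inv_seq f k)`_k else 0.
have gP : psupp g by case.
exists g => //; apply: psupp_eq; first exact: psupp_cmul.
  by move=> n; rewrite /lone; case: eqVneq => // ->.
case=> [|n]; rewrite cmulC cmul_nat//.
  by rewrite big_ord1 /= mul1r subn0 f0.
(* The newest coefficient multiplies f 0 = 1 and was chosen as minus the rest of the sum. *)
rewrite big_ord_recr /= subnn f0 mulr1 nth_rcons size_inv_seq ltnn eqxx.
apply/eqP; rewrite subr_eq0; apply/eqP/eq_bigr => i _.
have le_in : (i <= n)%N by rewrite -ltnS.
by rewrite mulrC (nth_inv_seq _ le_in).
Qed.

Definition exp_ser (n : int) : int -> F := exp_coef F n.

Lemma psupp_exp_ser n : psupp (exp_ser n).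
Proof. by case. Qed.

Lemma exp_ser_supp i n : exp_ser i n <> 0 -> 0 <= n.
Proof. exact: psupp_exp_ser. Qed.

Lemma fact_neq0 (k : nat) : k`!%:R != 0 :> F.
Proof. by rewrite pnatr_eq0 -lt0n fact_gt0. Qed.

(** At x^k this is the binomial theorem for (n + m)^k, divided by k!. *)
Lemma exp_serD n m : exp_ser (n + m) = cmul (exp_ser n) (exp_ser m).
Proof.
apply: psupp_eq; [exact: psupp_exp_ser|by apply: psupp_cmul;
  exact: psupp_exp_ser|move=> k].
rewrite cmul_nat; [|exact: psupp_exp_ser|exact: psupp_exp_ser].
rewrite /exp_ser /exp_coef intrD addrC exprDn mulr_suml; apply: eq_bigr => i _.
have ik : (i <= k)%N by rewrite -ltnS.
rewrite -mulr_natr -(bin_fact ik) !natrM.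
have := fact_neq0 i; have := fact_neq0 (k - i); have := fact_neq0 k.
rewrite -{1}(bin_fact ik) natrM mulf_eq0 => /norP[b0 _] h1 h2.
by field; rewrite h1 h2 b0.
Qed.

Lemma exp_ser0 : exp_ser 0 = @lone F.
Proof.
apply/funext => -[[|k]|k] //; rewrite /exp_ser /exp_coef /lone/=.
  by rewrite expr0 fact0 divr1.
by rewrite mulr0z exprS !mul0r.
Qed.

Local Notation e := (@expx_sub1 F).

Lemma expx_sub1_supp n : e n <> 0 -> 1 <= n.
Proof.
case: n => [[|n]|n]//.
  by rewrite /expx_sub1 /lone /= expr0 fact0 divr1 subrr.
by rewrite /expx_sub1 /lone /= subr0.
Qed.

(** The series e^x - 1 is x times a power series with constant term 1; the inverse of the latter,
    divided by x, has order at least -1. *)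
Lemma expx_sub1_inv : exists h, (forall n, h n <> 0 -> -1 <= n) /\ cmul e h = @lone F.
Proof.
pose e1 (n : int) := e (n + 1).
have e1P : psupp e1 by move=> n /expx_sub1_supp; lia.
have [|g gP eg] := psupp_inv e1P.
  by rewrite /e1 /expx_sub1 /lone /= mulr1z expr1 (_ : 1`! = 1)%N// divr1 subr0.
exists (fun n => g (n + 1)); split; first by move=> n /gP; lia.
rewrite -eg; apply/funext => n; rewrite /cmul /conv.
rewrite [LHS](reindex_fsbigT (fun p : int => p + 1)).
  by apply: eq_fsbigr => p _; rewrite /e1 opprD addrA subrK.
by exists (fun p : int => p - 1) => p; rewrite (addrK, subrK).
Qed.

Lemma laur_iter f k : laur f -> laur (iter k (lmul f) (@lone F)).
Proof.
move=> fl; elim: k => [|k IHk]; first exact: laur_lone.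
by rewrite iterS; exact: laur_cmul.
Qed.

(** [linv] selects some Laurent inverse h; associativity on Laurent series gives h = (g f) h = g (f
    h) = g. *)
Lemma linv_uniq f g : laur f -> laur g -> cmul f g = @lone F -> linv f = g.
Proof.
move=> fl gl fg; rewrite /linv; case: xgetP => [h _ [hl fh]|].
  have {}hl : laur h by apply/(@is_laurentP F^o).
  by rewrite -[h]cmul1 -fg [cmul f g]cmulC -laur_cmulA// -[cmul f h]/(lmul f h) fh cmulC cmul1.
move=> /(_ g); case; split; last exact: fg.
exact/(@is_laurentP F^o).
Qed.

Definition expm1_pow (i : int) : int -> F := lexp e i.

(** At a negative exponent [lexp] inverts a whole power of e^x - 1. Identifying this with a power of
    the inverse [h] gives both the bound on the support and a recursion that passes through exponent
    0. *)
Lemma expm1_pow_rec : (forall i n, expm1_pow i n <> 0 -> i <= n) /\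
  (forall i, expm1_pow (i + 1) = cmul e (expm1_pow i)).
Proof.
have [h [hs eh]] := expx_sub1_inv.
have el : laur e by exists 1; exact: expx_sub1_supp.
have hl : laur h by exists (-1).
have es k n : iter k (lmul e) (@lone F) n <> 0 -> k%:Z <= n.
  elim: k n => [|k IHk] n; first by rewrite /= /lone; case: eqVneq => // ->.
  by rewrite iterS => /cmul_neq0[p [/expx_sub1_supp ? /IHk]]; lia.
have hks k n : iter k (lmul h) (@lone F) n <> 0 -> - k%:Z <= n.
  elim: k n => [|k IHk] n; first by rewrite /= /lone; case: eqVneq => // ->.
  by rewrite iterS => /cmul_neq0[p [/hs ? /IHk]]; lia.
have ehk k : cmul (iter k (lmul e) (@lone F)) (iter k (lmul h) (@lone F)) = @lone F.
  elim: k => [|k IHk]; first exact: cmul1.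
  have lek := laur_iter k el; have lhk := laur_iter k hl.
  rewrite !iterS -![lmul _ _]/(cmul _ _).
  rewrite -laur_cmulA//; last exact: laur_cmul.
  by rewrite [cmul h _]cmulC [cmul (iter _ _ _) _]laur_cmulA// IHk cmul1.
have EN k : expm1_pow (Negz k) = iter k.+1 (lmul h) (@lone F).
  by rewrite /expm1_pow /lexp; apply: linv_uniq => //; apply: laur_iter.
split=> [[k|k] n|].
- exact: es.
- by rewrite EN => /hks; rewrite NegzE.
case=> k; first by rewrite -PoszD addn1.
rewrite EN (_ : Negz k + 1 = - k%:Z); last by lia.
have -> : expm1_pow (- k%:Z) = iter k (lmul h) (@lone F).
  by case: k => [//|k]; rewrite -NegzE EN.
by rewrite iterS -[lmul _ _]/(cmul _ _) laur_cmulA ?eh ?cmul1//; exact: laur_iter.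
Qed.

Lemma expm1_pow_supp i n : expm1_pow i n <> 0 -> i <= n.
Proof. exact: expm1_pow_rec.1. Qed.

Lemma laur_expm1_pow i : laur (expm1_pow i).
Proof. by exists i; exact: expm1_pow_supp. Qed.

Lemma expm1_pow0 : expm1_pow 0 = @lone F. Proof. by []. Qed.

Lemma expm1_pow1 : expm1_pow 1 = e.
Proof. by rewrite -[1]add0r expm1_pow_rec.2 expm1_pow0 cmulC cmul1. Qed.

Lemma expm1_powD i j : expm1_pow (i + j) = cmul (expm1_pow i) (expm1_pow j).
Proof.
apply: (@family_add _ laur (@cmul F _) (@lone F) _ _ _ expm1_pow e) => //.
- exact: cmulC.
- exact: laur_cmulA.
- exact: cmul1.
- by exists 1; exact: expx_sub1_supp.
- exact: laur_expm1_pow.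
- exact: expm1_pow_rec.2.
Qed.

(* e^(m x) (e^x - 1)^i *)
Definition exp_expm1 (m i : int) := cmul (exp_ser m) (expm1_pow i).

Lemma laur_exp_ser m : laur (exp_ser m).
Proof. exact/psupp_laur/psupp_exp_ser. Qed.

Lemma laur_exp_expm1 m i : laur (exp_expm1 m i).
Proof. by apply: laur_cmul; [exact: laur_exp_ser|exact: laur_expm1_pow]. Qed.

Lemma exp_expm1_supp m i n : exp_expm1 m i n <> 0 -> i <= n.
Proof. by move=> /cmul_neq0[p [/exp_ser_supp ? /expm1_pow_supp]]; lia. Qed.

Lemma exp_expm1D m m' i i' :
  exp_expm1 (m + m') (i + i') = cmul (exp_expm1 m i) (exp_expm1 m' i').
Proof.
have lex := laur_exp_ser; have lE := laur_expm1_pow.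
have l := laur_cmul.
rewrite /exp_expm1 exp_serD expm1_powD -!laur_cmulA//; do ?exact: l.
by congr (cmul _ _); rewrite ![cmul (expm1_pow i) _]cmulC !laur_cmulA//; exact: l.
Qed.

Lemma exp_expm1_0l i : exp_expm1 0 i = expm1_pow i.
Proof. by rewrite /exp_expm1 exp_ser0 cmul1. Qed.

Lemma exp_expm1_0r m : exp_expm1 m 0 = exp_ser m.
Proof. by rewrite /exp_expm1 expm1_pow0 cmulC cmul1. Qed.

Lemma expm1_pow_mul_exp m i j :
  cmul (expm1_pow i) (exp_expm1 m j) = exp_expm1 m (i + j).
Proof. by rewrite -[m in RHS]add0r exp_expm1D exp_expm1_0l. Qed.

(* (1 + eps x)^i *)
Definition binser (eps : F) (i : int) : int -> F :=
  fun n => if n is Posz k then eps ^+ k * binz F i k else 0.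

Lemma psupp_binser eps i : psupp (binser eps i).
Proof. by case. Qed.

Lemma binser_supp eps i n : binser eps i n <> 0 -> 0 <= n.
Proof. exact: psupp_binser. Qed.

Lemma binz0 i : binz F i 0 = 1.
Proof. by rewrite /binz big_ord0 fact0 divr1. Qed.

(** Pascal's rule for an integer upper index: the three products share the factor i (i - 1) ... (i -
    k + 1), obtained by splitting off the first or the last term. *)
Lemma binzS (i : int) k : binz F (i + 1) k.+1 = binz F i k.+1 + binz F i k.
Proof.
rewrite /binz big_ord_recl /= subr0.
rewrite (eq_bigr (fun j : 'I_k => (i - j%:Z)%:~R)); last first.
  by move=> j _; congr (_%:~R); rewrite /bump /=; lia.
rewrite [in RHS]big_ord_recr/= factS natrM.
have h := fact_neq0 k; have k0 : k.+1%:R != 0 :> F by rewrite pnatr_eq0.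
set p := \prod_(i0 < k) _.
rewrite intrB (intrD F i 1) mulr1z -(pmulrn _ k).
by move: k0; rewrite -[k.+1]addn1 natrD => k0; field; rewrite h k0.
Qed.

Lemma binz0S k : binz F 0 k.+1 = 0.
Proof. by rewrite /binz big_ord_recl /= subr0 mulr0z !mul0r. Qed.

Lemma binz_nat (n k : nat) : binz F n k = 'C(n, k)%:R.
Proof.
elim: n k => [|n IHn] [|k]; rewrite ?binz0 ?bin0 ?binz0S//.
by rewrite -addn1 PoszD binzS !IHn addn1 binS natrD.
Qed.

Lemma binser0 eps : binser eps 0 = @lone F.
Proof.
apply/funext => -[[|k]|k] //; rewrite /binser /lone /=.
  by rewrite binz0 mulr1.
by rewrite binz0S mulr0.
Qed.

Lemma binser1 eps (n : int) : binser eps 1 n = delta F 0 n + eps * delta F 1 n.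
Proof.
have h k : binz F 1 k = binz F (0 + 1) k by [].
case: n => [[|[|k]]|k]; rewrite /binser /delta ?h ?binzS ?binz0S ?binz0 /=; ring.
Qed.

Lemma binserS eps (i : int) : binser eps (i + 1) = cmul (binser eps 1) (binser eps i).
Proof.
have P := psupp_binser.
apply: psupp_eq; [exact: P|by apply: psupp_cmul; exact: P|].
case=> [|k]; rewrite cmul_nat ?big_ord_recl//=.
  by rewrite big_ord0 !binz0; ring.
rewrite /bump /= [X in _ + (_ + X)]big1; last first.
  move=> j _; rewrite !add1n (binzS 0) !binz0S addr0 mulr0 mul0r//.
rewrite addn0 subn0 subn1 /= binz0 -[binz F 1 1]/(binz F (0 + 1) 1) binzS binzS.
rewrite binz0S binz0 exprS; ring.
Qed.

Lemma binserD eps i j : binser eps (i + j) = cmul (binser eps i) (binser eps j).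
Proof.
apply: (@family_add _ laur (@cmul F _) (@lone F) _ _ _ (binser eps) (binser eps 1)) => //.
- exact: cmulC.
- exact: laur_cmulA.
- exact: cmul1.
- exact/psupp_laur/binser_supp.
- by move=> k; exact/psupp_laur/binser_supp.
- exact: binser0.
- exact: binserS.
Qed.

(* (1 + (e^x - 1))^i = e^(i x) *)
Lemma binser_expm1_pow i : capp expm1_pow (binser 1 i) = exp_ser i.
Proof.
have P k : psupp (capp expm1_pow (binser 1 k)).
  move=> n h; have [j [/expm1_pow_supp ? /binser_supp]] := capp_neq0 h; lia.
have capp_add i' j : capp expm1_pow (binser 1 (i' + j))
    = cmul (capp expm1_pow (binser 1 i')) (capp expm1_pow (binser 1 j)).
  apply/funext => k; rewrite binserD (@capp_cmul _ _ _ _ expm1_pow)//.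
    exact: expm1_powD.
  apply: (@finite_int3 (`|k|)) => -[[p q] r] /=.
  by move=> [/binser_supp ? /binser_supp ? /expm1_pow_supp ? /expm1_pow_supp];
    rewrite /bounded; lia.
(* At exponent 1 the claim is 1 + (e^x - 1) = e^x. *)
have c1 : capp expm1_pow (binser 1 1) = exp_ser 1.
  apply/funext => k; rewrite /capp.
  have -> : binser 1 1 = (fun n => delta F 0 n + delta F 1 n).
    by apply/funext => n; rewrite binser1 mul1r.
  have fin1 (d : int) : finite_set [set p : int | expm1_pow p k <> 0 /\ delta F d p <> 0].
    by apply: sub_finite_set (finite_set1 d) => p [_]; rewrite /delta; case: eqVneq.
  rewrite (@appD F F^o)// -![app _ _ _]/(capp _ _ _) !app_delta.
  by rewrite expm1_pow0 expm1_pow1 /expx_sub1 /exp_ser; exact: subrKC.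
(* Both sides are families with the exponent law, generated by e^x. *)
apply: (@family_eq _ laur (@cmul F _) (@lone F) _ _ _ (fun i => capp expm1_pow (binser 1 i)) exp_ser (exp_ser 1)).
- exact: cmulC.
- exact: laur_cmulA.
- exact: cmul1.
- exact: laur_exp_ser.
- by move=> k; apply/psupp_laur.
- exact: laur_exp_ser.
- by rewrite binser0 (@app_delta F _ _ expm1_pow 0).
- exact: exp_ser0.
- by move=> k; rewrite capp_add c1 cmulC.
- by move=> k; rewrite exp_serD cmulC.
Qed.

(** These are the coefficients of x0^a x2^b in e^(m (x0 + x2)) and in e^(m x0) e^(m x2). *)
Lemma binser_exp_ser m a b :
  binser 1 (a + b) b * exp_ser m (a + b) = exp_ser m a * exp_ser m b.
Proof.
case: b => [b|b]; last by rewrite mul0r mulr0.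
case: a => [a|a].
  rewrite -PoszD /binser /exp_ser /exp_coef binz_nat expr1n mul1r.
  have := bin_fact (leq_addl a b); rewrite addnK => /(congr1 (fun n => n%:R : F)).
  rewrite !natrM => <-.
  have := fact_neq0 (a + b); have := fact_neq0 a; have := fact_neq0 b.
  rewrite -(bin_fact (leq_addl a b)) addnK !natrM !mulf_eq0 => h1 h2 /norP[h3 _].
  by rewrite exprD; field; rewrite h1 h2 h3.
(* For negative [a] the right side is 0; on the left either a + b < 0 kills the exponential
   coefficient, or b > a + b kills the binomial one. *)
rewrite [exp_ser m (Negz a)]/=  mul0r.
have [ab0|ab0] := ltP (Negz a + b%:Z) 0.
  case: (Negz a + b%:Z) ab0 => // n _; exact: mulr0.
have [n nE] : exists n : nat, Negz a + b%:Z = n.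
  by exists (absz (Negz a + b%:Z)); lia.
by rewrite nE /binser binz_nat bin_small ?mulr0 ?mul0r//; lia.
Qed.

End OneVariable.

Lemma norm_bounds (x : int) : - `|x| <= x /\ x <= `|x|.
Proof. by split; lia. Qed.

(** Absolute values are generalised to fresh integers known only through their bounds, so that the
    remaining goals are linear. *)
Ltac box_lia := rewrite /bounded;
  repeat match goal with
  | |- context [Num.norm ?x] =>
      have := norm_bounds x; move: (Num.norm x) => ? [? ?]
  end; repeat (apply/andP; split); lia.

(** * Supports of two-variable series and the matrices acting on them *)

Section SupportClasses.
Variable W : zmodType.
Implicit Type A : int * int -> W.

(* W((x1))((x2)) *)
Definition ser12 A := exists (k : int) (g : int -> int), forall a b : int,
  A (a, b) <> 0 -> k <= b /\ forall M : int, b <= M -> g M <= a.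

(* W((x2))((x1)) *)
Definition ser21 A := exists (k : int) (g : int -> int), forall a b : int,
  A (a, b) <> 0 -> k <= a /\ forall M : int, a <= M -> g M <= b.

Definition laurent2 A :=
  exists N : int, forall a b : int, A (a, b) <> 0 -> N <= a /\ N <= b.

Definition power2 A := forall a b : int, A (a, b) <> 0 -> 0 <= a /\ 0 <= b.

Lemma power2_laurent2 A : power2 A -> laurent2 A.
Proof. by exists 0. Qed.

Lemma laurent2_ser12 A : laurent2 A -> ser12 A.
Proof. by move=> [N AN]; exists N, (fun=> N) => a b /AN[]. Qed.

Lemma laurent2_ser21 A : laurent2 A -> ser21 A.
Proof. by move=> [N AN]; exists N, (fun=> N) => a b /AN[]. Qed.

End SupportClasses.

Section KernelClasses.
Variable F : numFieldType.
Implicit Types Phi Psi : int * int -> int * int -> F.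

(* Shapes of matrices for which the sums defining app are finite on W((x1))((x2)),
   W((x2))((x1)) and W((x1, x2)) respectively.  The alternative in tri2 covers
   both x2 -> e^x2 - 1 and x0 -> x2 (e^x0 - 1). *)
Definition tri1 Phi := forall a b c d : int, Phi (a, b) (c, d) <> 0 ->
  b <= d /\ a + b <= c + d.

Definition tri2 (D : int) Phi := forall a b c d : int, Phi (a, b) (c, d) <> 0 ->
  a <= c /\ (b <= d + D \/ a + b <= d + D).

Definition tri3 Phi := forall a b c d : int, Phi (a, b) (c, d) <> 0 ->
  0 <= c /\ a + b <= c + d.

Section Action.
Variable W : lmodType F.
Implicit Types (A B : int * int -> W) (q : int * int -> F).

Lemma conv_neq0_2 q A (a b : int) : conv q A (a, b) <> 0 ->
  exists p1 p2 : int, q (p1, p2) <> 0 /\ A (a - p1, b - p2) <> 0.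
Proof. by move=> h; have [[p1 p2] ?] := conv_neq0 h; exists p1, p2. Qed.

(** For two-variable series, finiteness is certified by a single bound [B] on all the exponents
    involved. *)
Lemma convA_2 (B : int) q q' A (a b : int) :
    (forall p1 p2 r1 r2 : int, q (p1, p2) <> 0 -> q' (r1, r2) <> 0 ->
      A (a - p1 - r1, b - p2 - r2) <> 0 ->
      [&& bounded B p1, bounded B p2, bounded B r1 & bounded B r2]) ->
  conv q (conv q' A) (a, b) = conv (cmul q q') A (a, b).
Proof.
move=> h; apply: convA; apply: (@finite_int4 B) => -[[p1 p2] [r1 r2]] [/= ? ? ?].
exact: h.
Qed.

Lemma app_conv_2 (B : int) Phi Psi q A (a b : int) :
    (forall p r, Phi (p + r) = cmul (Psi p) (Phi r)) ->
    (forall p1 p2 r1 r2 s1 s2 : int, q (p1, p2) <> 0 -> A (r1, r2) <> 0 ->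
      Psi (p1, p2) (s1, s2) <> 0 -> Phi (r1, r2) (a - s1, b - s2) <> 0 ->
      [&& bounded B p1, bounded B p2, bounded B r1, bounded B r2,
          bounded B s1 & bounded B s2]) ->
  app Phi (conv q A) (a, b) = conv (capp Psi q) (app Phi A) (a, b).
Proof.
move=> PM h; apply: app_conv => //.
apply: (@finite_int6 B) => -[[[p1 p2] [r1 r2]] [s1 s2]] [/= ? ? ? ?].
exact: h.
Qed.

Lemma app_app_2 (B : int) Phi Psi A (a b : int) :
    (forall p1 p2 r1 r2 : int, A (p1, p2) <> 0 -> Phi (p1, p2) (r1, r2) <> 0 ->
      Psi (r1, r2) (a, b) <> 0 ->
      [&& bounded B p1, bounded B p2, bounded B r1 & bounded B r2]) ->
  app Psi (app Phi A) (a, b) = app (fun i => capp Psi (Phi i)) A (a, b).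
Proof.
move=> h; apply: app_app.
apply: (@finite_int4 B) => -[[p1 p2] [r1 r2]] [/= ? ? ?].
exact: h.
Qed.

Lemma convDr_2 (B : int) q A A' (a b : int) :
    (forall p1 p2 : int, q (p1, p2) <> 0 ->
      A (a - p1, b - p2) <> 0 \/ A' (a - p1, b - p2) <> 0 ->
      bounded B p1 && bounded B p2) ->
  conv q (fun p => A p + A' p) (a, b) = conv q A (a, b) + conv q A' (a, b).
Proof.
move=> h; apply: convDr; apply: (@finite_int2 B) => -[p1 p2] [/= ? ?]; apply: h => //.
  by left.
by right.
Qed.

Lemma appD_2 (B : int) Phi A A' (t : int * int) :
    (forall p1 p2 : int, Phi (p1, p2) t <> 0 ->
      A (p1, p2) <> 0 \/ A' (p1, p2) <> 0 ->
      bounded B p1 && bounded B p2) ->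
  app Phi (fun p => A p + A' p) t = app Phi A t + app Phi A' t.
Proof.
move=> h; apply: appD; apply: (@finite_int2 B) => -[p1 p2] [/= ? ?]; apply: h => //.
  by left.
by right.
Qed.

(** When b <= M, the exponent of x2 in each factor is at most M minus the lower bound for the other
    factor, and this bounds the exponents of x1 in both. *)
Lemma conv_ser12 q A : ser12 q -> ser12 A -> ser12 (conv q A).
Proof.
move=> [k [g qg]] [k' [g' Ag]].
exists (k + k'), (fun M => g (M - k') + g' (M - k)) => a b h.
have [p1 [p2 [/qg[q1 q2] /Ag[A1 A2]]]] := conv_neq0_2 h.
split=> [|M bM]; first by lia.
have {}/q2 q2 : p2 <= M - k' by lia.
have {}/A2 A2 : b - p2 <= M - k by lia.
by apply: le_trans (lerD q2 A2) _; rewrite addrC subrK.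
Qed.

Lemma conv_ser21 q A : ser21 q -> ser21 A -> ser21 (conv q A).
Proof.
move=> [k [g qg]] [k' [g' Ag]].
exists (k + k'), (fun M => g (M - k') + g' (M - k)) => a b h.
have [p1 [p2 [/qg[q1 q2] /Ag[A1 A2]]]] := conv_neq0_2 h.
split=> [|M bM]; first by lia.
have {}/q2 q2 : p1 <= M - k' by lia.
have {}/A2 A2 : a - p1 <= M - k by lia.
by apply: le_trans (lerD q2 A2) _; rewrite addrC subrK.
Qed.

Lemma conv_laurent2 q A : laurent2 q -> laurent2 A -> laurent2 (conv q A).
Proof.
move=> [N qN] [N' AN]; exists (N + N') => a b h.
have [p1 [p2 [/qN[q1 q2] /AN[A1 A2]]]] := conv_neq0_2 h.
by lia.
Qed.

(** A contribution from (p1, p2) to (a, b) has k <= p2 <= b, so b <= M yields a >= p1 + p2 - b >= g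
    M + k - M. *)
Lemma app_ser12 Phi A : tri1 Phi -> ser12 A -> ser12 (app Phi A).
Proof.
move=> tP [k [g Ag]]; exists k, (fun M => g M + k - M) => a b h.
have [[p1 p2] [/tP[q1 q2] /Ag[A1 A2]]] := app_neq0 h.
split=> [|M bM]; first by lia.
by have := A2 M; lia.
Qed.

Lemma app_ser21 D Phi A : tri2 D Phi -> ser21 A -> ser21 (app Phi A).
Proof.
move=> tP [k [g Ag]]; exists k, (fun M => g M - D - `|k|) => a b h.
have [[p1 p2] [/tP[q1 q2] /Ag[A1 A2]]] := app_neq0 h.
split=> [|M bM]; first by lia.
by have := A2 M; lia.
Qed.

(** The total degree stays bounded below and the new first exponent is nonnegative, so an upper
    bound on the latter bounds the second exponent below. *)
Lemma app_ser3 Phi A : tri3 Phi -> laurent2 A -> ser21 (app Phi A).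
Proof.
move=> tP [N AN]; exists 0, (fun M => N + N - M) => a b h.
have [[p1 p2] [/tP[q1 q2] /AN[A1 A2]]] := app_neq0 h.
by split=> [|M bM]; lia.
Qed.

Lemma convA1 q q' A : ser12 q -> ser12 q' -> ser12 A ->
  conv q (conv q' A) = conv (cmul q q') A.
Proof.
move=> [k [g qg]] [k' [g' qg']] [l [h Ah]]; apply/funext => -[a b].
(* Upper bounds for the exponents of x2 in [q], [q'] and [A], each from the total [b] and the lower
   bounds for the other two; the bound functions are evaluated there. *)
pose X := b - k' - l; pose X' := b - k - l; pose Y := b - k - k'.
apply: (@convA_2 (`|a| + `|b| + `|k| + `|k'| + `|l|
  + `|g X| + `|g' X'| + `|h Y|)) => p1 p2 r1 r2.
move=> /qg[? /(_ X)?] /qg'[? /(_ X')?] /Ah[? /(_ Y)?].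
all: box_lia.
Qed.

Lemma convA2 q q' A : ser21 q -> ser21 q' -> ser21 A ->
  conv q (conv q' A) = conv (cmul q q') A.
Proof.
move=> [k [g qg]] [k' [g' qg']] [l [h Ah]]; apply/funext => -[a b].
pose X := a - k' - l; pose X' := a - k - l; pose Y := a - k - k'.
apply: (@convA_2 (`|a| + `|b| + `|k| + `|k'| + `|l|
  + `|g X| + `|g' X'| + `|h Y|)) => p1 p2 r1 r2.
move=> /qg[? /(_ X)?] /qg'[? /(_ X')?] /Ah[? /(_ Y)?].
all: box_lia.
Qed.

Lemma app_conv1 Phi Psi q A : tri1 Phi -> tri1 Psi ->
    (forall p r, Phi (p + r) = cmul (Psi p) (Phi r)) -> ser12 q -> ser12 A ->
  app Phi (conv q A) = conv (capp Psi q) (app Phi A).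
Proof.
move=> tP tP' PM [k [g qg]] [k' [g' Ag]]; apply/funext => -[a b].
pose X := b - k'; pose X' := b - k.
apply: (@app_conv_2 (`|a| + `|b| + `|a| + `|b| + `|k| + `|k'| + `|k| + `|k'|
  + `|g X| + `|g' X'|)) => // p1 p2 r1 r2 s1 s2.
move=> /qg[? /(_ X)?] /Ag[? /(_ X')?] /tP'[? ?] /tP[? ?].
all: box_lia.
Qed.

Lemma app_conv2 D D' Phi Psi q A : tri2 D Phi -> tri2 D' Psi ->
    (forall p r, Phi (p + r) = cmul (Psi p) (Phi r)) -> ser21 q -> ser21 A ->
  app Phi (conv q A) = conv (capp Psi q) (app Phi A).
Proof.
move=> tP tP' PM [k [g qg]] [k' [g' Ag]]; apply/funext => -[a b].
pose X := a - k'; pose X' := a - k.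
apply: (@app_conv_2 (`|a| + `|b| + `|a| + `|b| + `|k| + `|k'| + `|k| + `|k'|
  + `|D| + `|D'| + `|g X| + `|g' X'|)) => // p1 p2 r1 r2 s1 s2.
move=> /qg[? /(_ X)?] /Ag[? /(_ X')?] /tP'[? h1] /tP[? h2].
(* Both alternatives of [tri2] are weakened to one bound, by means of the lower bound on the first
   exponent. *)
have {}h1 : p2 <= s2 + (`|D'| + `|k|) by lia.
have {}h2 : r2 <= b - s2 + (`|D| + `|k'|) by lia.
all: box_lia.
Qed.

Lemma app_conv3 Phi Psi q A : tri3 Phi -> tri3 Psi ->
    (forall p r, Phi (p + r) = cmul (Psi p) (Phi r)) -> laurent2 q -> laurent2 A ->
  app Phi (conv q A) = conv (capp Psi q) (app Phi A).
Proof.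
move=> tP tP' PM [k qg] [k' Ag]; apply/funext => -[a b].
pose B := `|a| + `|b| + `|k| + `|k| + `|k'| + `|k'|.
apply: (@app_conv_2 (B + B)) => // p1 p2 r1 r2 s1 s2.
move=> /qg[? ?] /Ag[? ?] /tP'[? ?] /tP[? ?].
all: box_lia.
Qed.

Lemma app_app1 Phi Psi A : tri1 Phi -> tri1 Psi -> ser12 A ->
  app Psi (app Phi A) = app (fun i => capp Psi (Phi i)) A.
Proof.
move=> tP tP' [k [g Ag]]; apply/funext => -[a b].
apply: (@app_app_2 (`|a| + `|b| + `|b| + `|k| + `|k| + `|g b|)) => p1 p2 r1 r2.
move=> /Ag[? /(_ b)?] /tP[? ?] /tP'[? ?].
all: box_lia.
Qed.

(** The case in view is x1 = x2 + x0 followed by x0 = x2 (e^z - 1): the intermediate exponents of x0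
    lie between 0 and [a]. *)
Lemma app_app3 D Phi Psi A : tri3 Phi -> tri2 D Psi -> laurent2 A ->
  app Psi (app Phi A) = app (fun i => capp Psi (Phi i)) A.
Proof.
move=> tP tP' [k Ag]; apply/funext => -[a b].
apply: (@app_app_2 (`|a| + `|a| + `|b| + `|D| + `|k| + `|k|)) => p1 p2 r1 r2.
move=> /Ag[? ?] /tP[? ?] /tP'[? [?|?]].
all: box_lia.
Qed.

Lemma convD1 q A B : ser12 q -> ser12 A -> ser12 B ->
  conv q (fun p => A p + B p) = (fun p => conv q A p + conv q B p).
Proof.
move=> [k [g qg]] [k1 [g1 Ag]] [k2 [g2 Bg]]; apply/funext => -[a b].
pose X1 := b - k1; pose X2 := b - k2; pose X := b - k.
apply: (@convDr_2 (`|a| + `|b| + `|k| + `|k1| + `|k2|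
  + `|g X1| + `|g X2| + `|g1 X| + `|g2 X|)) => p1 p2.
move=> /qg[? qX] [/Ag[? /(_ X) ?]|/Bg[? /(_ X) ?]].
  by have := qX X1; box_lia.
by have := qX X2; box_lia.
Qed.

Lemma convD2 q A B : ser21 q -> ser21 A -> ser21 B ->
  conv q (fun p => A p + B p) = (fun p => conv q A p + conv q B p).
Proof.
move=> [k [g qg]] [k1 [g1 Ag]] [k2 [g2 Bg]]; apply/funext => -[a b].
pose X1 := a - k1; pose X2 := a - k2; pose X := a - k.
apply: (@convDr_2 (`|a| + `|b| + `|k| + `|k1| + `|k2|
  + `|g X1| + `|g X2| + `|g1 X| + `|g2 X|)) => p1 p2.
move=> /qg[? qX] [/Ag[? /(_ X) ?]|/Bg[? /(_ X) ?]].
  by have := qX X1; box_lia.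
by have := qX X2; box_lia.
Qed.

Lemma appD1 Phi A B : tri1 Phi -> ser12 A -> ser12 B ->
  app Phi (fun p => A p + B p) = (fun p => app Phi A p + app Phi B p).
Proof.
move=> tP [k1 [g1 Ag]] [k2 [g2 Bg]]; apply/funext => -[a b].
apply: (@appD_2 (`|a| + `|b| + `|k1| + `|k2| + `|g1 b| + `|g2 b|)) => p1 p2.
move=> /tP[? ?] [/Ag[? /(_ b) ?]|/Bg[? /(_ b) ?]].
all: box_lia.
Qed.

Lemma appD3 Phi A B : tri3 Phi -> laurent2 A -> laurent2 B ->
  app Phi (fun p => A p + B p) = (fun p => app Phi A p + app Phi B p).
Proof.
move=> tP [k1 Ag] [k2 Bg]; apply/funext => -[a b].
apply: (@appD_2 (`|a| + `|b| + `|k1| + `|k2|)) => p1 p2.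
by move=> /tP[? ?] [/Ag[? ?]|/Bg[? ?]]; box_lia.
Qed.

End Action.

End KernelClasses.

(** * The substitution matrices and their exponent laws *)

Section Kernels.
Variable F : numFieldType.
Implicit Types (f g : int -> F) (q : int * int -> F).

Lemma boolr_neq0 (b : bool) (x : F) : b%:R * x <> 0 -> b /\ x <> 0.
Proof. by case: b; rewrite ?mul1r ?mul0r. Qed.

Lemma cmulA1 q q' q'' : ser12 q -> ser12 q' -> ser12 q'' ->
  cmul q (cmul q' q'') = cmul (cmul q q') q''.
Proof. exact: (@convA1 F F^o). Qed.

Lemma capp_cmul1 (Phi Psi : int * int -> int * int -> F) q q' :
    tri1 Phi -> tri1 Psi -> (forall p r, Phi (p + r) = cmul (Psi p) (Phi r)) ->
    ser12 q -> ser12 q' ->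
  capp Phi (cmul q q') = cmul (capp Psi q) (capp Phi q').
Proof. exact: (@app_conv1 F F^o). Qed.

Lemma capp_cmul3 (Phi Psi : int * int -> int * int -> F) q q' :
    tri3 Phi -> tri3 Psi -> (forall p r, Phi (p + r) = cmul (Psi p) (Phi r)) ->
    laurent2 q -> laurent2 q' ->
  capp Phi (cmul q q') = cmul (capp Psi q) (capp Phi q').
Proof. exact: (@app_conv3 F F^o). Qed.

Lemma capp_ser12 (Phi : int * int -> int * int -> F) q :
  tri1 Phi -> ser12 q -> ser12 (capp Phi q).
Proof. exact: (@app_ser12 F F^o). Qed.

Lemma capp_ser3 (Phi : int * int -> int * int -> F) q :
  tri3 Phi -> laurent2 q -> ser21 (capp Phi q).
Proof. exact: (@app_ser3 F F^o). Qed.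

Lemma cmul_delta (p k : int * int) q : cmul (delta F p) q k = q (k - p).
Proof. exact: (@conv_delta F F^o). Qed.

Lemma cmul_delta0 q : cmul (delta F 0) q = q.
Proof. by apply/funext => k; rewrite cmul_delta subr0. Qed.

Lemma delta_add (I : zmodType) (p r : I) :
  delta F (p + r) = cmul (delta F p) (delta F r).
Proof.
apply/funext => k; rewrite [RHS](@conv_delta F F^o) /delta.
by rewrite -subr_eq0 -[in RHS]subr_eq0 opprD addrA.
Qed.

Definition outer f g : int * int -> F := fun p => f p.1 * g p.2.

Lemma outer_cmul f g f' g' : laur f -> laur g -> laur f' -> laur g' ->
  cmul (outer f g) (outer f' g') = outer (cmul f f') (cmul g g').
Proof.
move=> [N fN] [M gM] [N' fN'] [M' gM']; apply/funext => -[a b].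
rewrite /cmul /conv /outer /=.
rewrite -(@fsum_pair _ _ _
  (fun p1 p2 : int => (f p1 * g p2) *: (f' (a - p1) * g' (b - p2) : F^o))); last first.
  apply: (@finite_int2 (`|a| + `|b| + `|N| + `|M| + `|N'| + `|M'|)) => -[p r] /=.
  by move=> /mul_neq0[/mul_neq0[/fN ? /gM ?] /mul_neq0[/fN' ? /gM' ?]]; box_lia.
rewrite mulr_fsuml; apply: eq_fsbigr => p _; rewrite mulr_fsumr.
apply: eq_fsbigr => r _.
rewrite -[LHS]/((f p * g r) * (f' (a - p) * g' (b - r))).
by rewrite -[RHS]/((f p * f' (a - p)) * (g r * g' (b - r))); ring.
Qed.

Lemma delta_outer (i j : int) : delta F (i, j) = outer (delta F i) (delta F j).
Proof.
apply/funext => -[a b]; rewrite /delta /outer xpair_eqE /=.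
by do 2 case: eqP => _; rewrite ?mul1r ?mul0r.
Qed.

(** A series homogeneous of total degree [d] is determined by its dependence on the second exponent,
    so that products of such series reduce to one-variable products. *)
Definition graded (d : int) f : int * int -> F :=
  fun p => (p.1 + p.2 == d)%:R * f p.2.

Lemma graded_cmul d d' f f' :
  cmul (graded d f) (graded d' f') = graded (d + d') (cmul f f').
Proof.
apply/funext => -[a b]; rewrite /cmul /conv.
(* The first factor lives on the line p1 + p2 = d, parametrised by the second exponent. *)
rewrite -(fsbig_widen ((fun t : int => (d - t, t)) @` setT))//; last first.
  move=> [p r] [_ /= nP]; apply/not_notP => /mul_neq0[/boolr_neq0[/= /eqP dE _] _].
  by apply: nP; exists r => //; rewrite -dE addrK.
rewrite fsbig_image; last by move=> t t' _ _ [].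
rewrite /graded /= mulr_fsumr; apply: eq_fsbigr => t _.
rewrite -![_ *: _]/(_ * _) subrK eqxx mul1r.
rewrite (_ : a - (d - t) + (b - t) == d' = (a + b == d + d')); last by lia.
by rewrite mulrCA.
Qed.

Definition swap q : int * int -> F := fun p => q (p.2, p.1).

Lemma swap_cmul q q' : swap (cmul q q') = cmul (swap q) (swap q').
Proof.
apply/funext => -[a b]; rewrite /swap /cmul /conv /=.
rewrite [LHS](reindex_fsbigT (fun p : int * int => (p.2, p.1)))//.
by exists (fun p : int * int => (p.2, p.1)) => -[].
Qed.

(* For each matrix below, the row at (i, j) is the image of the monomial
   x1^i x2^j or x0^i x2^j. *)

(* x1 = x0 + eps x2, expanded in nonnegative powers of x2 *)
Definition sub_add (eps : F) (p : int * int) : int * int -> F :=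
  graded (p.1 + p.2) (fun n => binser eps p.1 (n - p.2)).

(* x1 = x2 + x0, expanded in nonnegative powers of x0 *)
Definition sub_addC (p : int * int) : int * int -> F :=
  swap (graded (p.1 + p.2) (binser 1 p.1)).

(* x1^m x2^(d - m) A(x1, x2) at x1 = x2 e^x0 *)
Definition sub_exp (m d : int) (p : int * int) : int * int -> F :=
  outer (exp_ser F (m + p.1)) (delta F (p.1 + p.2 + d)).

(* e^(m x0) x2^d A(x2 (e^x0 - 1), x2) *)
Definition sub_scale_expm1 (m d : int) (p : int * int) : int * int -> F :=
  outer (exp_expm1 F m p.1) (delta F (p.1 + p.2 + d)).

(* e^(m x1) e^(n x2) A(e^x1 - 1, e^x2 - 1) *)
Definition sub_expm1 (m n : int) (p : int * int) : int * int -> F :=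
  outer (exp_expm1 F m p.1) (exp_expm1 F n p.2).

(* e^(m x0) e^((m + n) x2) A(e^x2 (e^x0 - 1), e^x2 - 1) *)
Definition sub_expm1_add (m n : int) (p : int * int) : int * int -> F :=
  outer (exp_expm1 F m p.1) (exp_expm1 F (m + n + p.1) p.2).

Lemma sub_addM eps p r : sub_add eps (p + r) = cmul (sub_add eps p) (sub_add eps r).
Proof.
rewrite graded_cmul /sub_add; congr graded; first by rewrite addrACA.
(* The shift by the exponent of x2 is multiplication by a monomial, which reduces the claim to
   [binserD]. *)
have shiftE j f : (fun n : int => f (n - j)) = cmul (delta F j) f.
  by apply/funext => n; rewrite [RHS](@conv_delta F F^o).
rewrite !(shiftE _ (binser eps _)) binserD delta_add.
have ld := laur_delta F; have lb i : laur (binser eps i).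
  exact/psupp_laur/psupp_binser.
have lc := laur_cmul.
rewrite -!laur_cmulA//; do ?exact: lc.
congr cmul; rewrite !laur_cmulA//; do ?exact: lc.
by rewrite [cmul (delta _ _) _]cmulC.
Qed.

Lemma sub_addCM p r : sub_addC (p + r) = cmul (sub_addC p) (sub_addC r).
Proof.
by rewrite /sub_addC -swap_cmul graded_cmul binserD; congr (swap (graded _ _));
  rewrite addrACA.
Qed.

(** The twist by [m] and [d] enters a product only once: the twisted substitution is semilinear over
    the untwisted one, in the form that [app_conv] asks for. *)
Lemma sub_expM m d p r : sub_exp m d (p + r) = cmul (sub_exp 0 0 p) (sub_exp m d r).
Proof.
rewrite /sub_exp outer_cmul; do ?[exact: laur_exp_ser|exact: laur_delta].
rewrite -exp_serD -delta_add; congr (outer (exp_ser F _) (delta F _)) => /=; lia.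
Qed.

Lemma sub_scale_expm1M m d p r :
  sub_scale_expm1 m d (p + r) = cmul (sub_scale_expm1 0 0 p) (sub_scale_expm1 m d r).
Proof.
rewrite /sub_scale_expm1 outer_cmul; do ?[exact: laur_exp_expm1|exact: laur_delta].
rewrite -exp_expm1D -delta_add add0r;
  congr (outer (exp_expm1 F _ _) (delta F _)) => /=; lia.
Qed.

Lemma sub_expm1M m n p r :
  sub_expm1 m n (p + r) = cmul (sub_expm1 0 0 p) (sub_expm1 m n r).
Proof. by rewrite /sub_expm1 outer_cmul; do ?exact: laur_exp_expm1;
  rewrite -!exp_expm1D !add0r. Qed.

Lemma sub_expm1_addM m n p r :
  sub_expm1_add m n (p + r) = cmul (sub_expm1_add 0 0 p) (sub_expm1_add m n r).
Proof.
have eqE : m + n + (p.1 + r.1) = (0 + 0 + p.1) + (m + n + r.1) by lia.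
rewrite /sub_expm1_add [(p + r).1]/(p.1 + r.1) [(p + r).2]/(p.2 + r.2) eqE.
rewrite outer_cmul; do ?exact: laur_exp_expm1.
by rewrite -!exp_expm1D (add0r m).
Qed.

Lemma sub_add_tri1 eps : tri1 (sub_add eps).
Proof. by move=> a b c d /boolr_neq0[/eqP/= ? /binser_supp]; lia. Qed.

(** For i >= 0 the binomial coefficients vanish beyond [i], so (x0 + eps x2)^i is a polynomial. *)
Lemma sub_add_pos eps (i j a b : int) : 0 <= i -> sub_add eps (i, j) (a, b) <> 0 -> 0 <= a /\ j <= b.
Proof.
case: i => // i _ /boolr_neq0[/eqP/= ab]; rewrite /binser.
case bj : (b - j) => [k|]// /mul_neq0[_]; rewrite binz_nat.
have [ki|ik] := leqP k i; first by move=> _; lia.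
by rewrite bin_small.
Qed.

Lemma sub_addC_tri3 : tri3 sub_addC.
Proof. by move=> a b c d /boolr_neq0[/eqP/= ? /binser_supp]; lia. Qed.

Lemma outer_neq0 f g a b : outer f g (a, b) <> 0 -> f a <> 0 /\ g b <> 0.
Proof. exact: mul_neq0. Qed.

Lemma delta_neq0 (p r : int) : delta F p r <> 0 -> r = p.
Proof. by rewrite /delta; case: eqVneq. Qed.

Lemma sub_exp_tri3 m : tri3 (sub_exp m 0).
Proof. by move=> a b c d /outer_neq0[/exp_ser_supp ? /delta_neq0/=]; lia. Qed.

Lemma sub_scale_expm1_tri2 m d : tri2 (- d) (sub_scale_expm1 m d).
Proof. by move=> a b c e /outer_neq0[/exp_expm1_supp/= ? /delta_neq0/=]; lia. Qed.

Lemma sub_expm1_tri1 m n : tri1 (sub_expm1 m n).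
Proof. by move=> a b c d /outer_neq0[/exp_expm1_supp/= ? /exp_expm1_supp/=]; lia. Qed.

Lemma sub_expm1_add_tri1 m n : tri1 (sub_expm1_add m n).
Proof. by move=> a b c d /outer_neq0[/exp_expm1_supp/= ? /exp_expm1_supp/=]; lia. Qed.

Lemma sub_expm1_add_tri2 m n : tri2 0 (sub_expm1_add m n).
Proof. by move=> a b c d /outer_neq0[/exp_expm1_supp/= ? /exp_expm1_supp/=]; lia. Qed.

End Kernels.

(** * Identities between composed substitutions *)

Section KernelIdentities.
Variable F : numFieldType.
Implicit Types (f g : int -> F) (q : int * int -> F).

Lemma pair_succ (i : int) : (i + 1, 0) = (1, 0) + (i, 0) :> (int * int)%type.
Proof. by apply: injective_projections => /=; rewrite ?addr0// addrC. Qed.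

Lemma pair_split (i j : int) : (i, j) = (i, 0) + (0, j) :> (int * int)%type.
Proof. by apply: injective_projections => /=; rewrite (addr0, add0r). Qed.

Lemma power2_ser12 (W : zmodType) (A : int * int -> W) : power2 A -> ser12 A.
Proof. by move=> /power2_laurent2/laurent2_ser12. Qed.

Lemma power2_ser21 (W : zmodType) (A : int * int -> W) : power2 A -> ser21 A.
Proof. by move=> /power2_laurent2/laurent2_ser21. Qed.

Lemma delta_laurent2 p : laurent2 (delta F p).
Proof.
exists (- `|p.1| - `|p.2|) => a b; rewrite /delta; case: p => i j.
by case: eqVneq => // -[-> ->] _ /=; lia.
Qed.

Lemma outer_laurent2 f g : laur f -> laur g -> laurent2 (outer f g).
Proof.
move=> [N fN] [M gM]; exists (- `|N| - `|M|) => a b /outer_neq0[/fN ? /gM ?].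
by lia.
Qed.

Lemma sub_add0 eps j : sub_add eps (0, j) = delta F (0, j).
Proof.
apply/funext => -[a b]; rewrite /sub_add /graded /= binser0 /lone /delta xpair_eqE.
rewrite -natrM mulnb subr_eq0; congr (_%:R); congr nat_of_bool.
by case: (b =P j) => [->|]; rewrite ?andbF//= add0r -subr_eq0 addrK.
Qed.

Lemma sub_add1 eps a b :
  sub_add eps (1, 0) (a, b) = delta F (1, 0) (a, b) + eps * delta F (0, 1) (a, b).
Proof.
rewrite /sub_add /graded /= subr0 binser1 /delta !xpair_eqE mulrDr.
congr (_ + _); last rewrite mulrCA.
  rewrite -natrM mulnb; congr (_%:R); congr nat_of_bool; lia.
congr (_ * _).
rewrite -natrM mulnb; congr (_%:R); congr nat_of_bool; lia.
Qed.

Lemma sub_add_split eps i j :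
  sub_add eps (i, j) = cmul (sub_add eps (i, 0)) (delta F (0, j)).
Proof. by rewrite -(sub_add0 eps) -sub_addM -pair_split. Qed.

Lemma tri1_ser12 (Phi : int * int -> int * int -> F) p : tri1 Phi -> ser12 (Phi p).
Proof.
move=> tP; rewrite -(@app_delta F _ _ Phi p).
exact/(capp_ser12 tP)/laurent2_ser12/delta_laurent2.
Qed.

Lemma appD1s (Phi : int * int -> int * int -> F) q q' : tri1 Phi -> ser12 q -> ser12 q' ->
  capp Phi (fun p => q p + q' p) = (fun p => capp Phi q p + capp Phi q' p).
Proof. exact: (@appD1 F F^o). Qed.

Lemma ser12Z eps q : ser12 q -> ser12 (fun p => eps * q p).
Proof. by move=> [k [g qg]]; exists k, g => a b /mul_neq0[_ /qg]. Qed.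

Lemma cappZ (Phi : int * int -> int * int -> F) eps q :
  capp Phi (fun p => eps * q p) = (fun p => eps * capp Phi q p).
Proof.
apply/funext => k; rewrite /capp /app mulr_fsumr; apply: eq_fsbigr => p _.
by rewrite -[LHS]/(Phi p k * (eps * q p)) mulrCA.
Qed.

(** Reduces an identity between two images of x1^i, for all integers i, to the case i = 1. *)
Lemma family2_eq (f f' : int -> int * int -> F) :
    (forall i, ser12 (f i)) -> (forall i, ser12 (f' i)) ->
    f 0 = delta F 0 -> f' 0 = delta F 0 -> f 1 = f' 1 ->
    (forall i, f (i + 1) = cmul (f 1) (f i)) ->
    (forall i, f' (i + 1) = cmul (f' 1) (f' i)) ->
  forall i, f i = f' i.
Proof.
move=> sf sf' f0 f'0 f1 fS f'S.
apply: (@family_eq _ (fun q => ser12 q) (@cmul F _) (delta F 0) _ _ _ f f' (f 1)) => //.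
- exact: cmulC.
- exact: cmulA1.
- exact: cmul_delta0.
- by rewrite f1.
Qed.

Lemma sub_add_inv eps p : capp (sub_add (- eps)) (sub_add eps p) = delta F p.
Proof.
have tS := @sub_add_tri1 F;
  have sS (e : F) p' : ser12 (sub_add e p') by exact: (tri1_ser12 _ (tS e)).
have dS p' : ser12 (delta F p') by exact/laurent2_ser12/delta_laurent2.
have eqE i : capp (sub_add (- eps)) (sub_add eps (i, 0)) = delta F (i, 0).
  move: i; apply: family2_eq.
  - by move=> i; apply: capp_ser12.
  - by move=> i; exact: dS.
  - by rewrite sub_add0 app_delta sub_add0.
  - by [].
  (* At exponent 1: (x1 - eps x2) + eps x2 = x1. *)
  - have -> : sub_add eps (1, 0) = (fun p => delta F (1, 0) p + eps * delta F (0, 1) p).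
      by apply/funext => -[a b]; exact: sub_add1.
    rewrite appD1s//; last exact: ser12Z.
    rewrite cappZ !app_delta sub_add0; apply/funext => -[a b].
    by rewrite sub_add1; ring.
  - by move=> i; rewrite pair_succ sub_addM (capp_cmul1 (tS _) (tS _) (sub_addM _)).
  - by move=> i; rewrite pair_succ delta_add.
case: p => i j;
  rewrite sub_add_split (capp_cmul1 (tS _) (tS _) (sub_addM _))// eqE app_delta sub_add0 -delta_add.
by rewrite -pair_split.
Qed.

(** In f(x0 + x2) only the term of degree a + b contributes to x0^a x2^b. *)
Lemma capp_sub_add_outerl f a b : laur f ->
  capp (sub_add 1) (outer f (@lone F)) (a, b) = binser 1 (a + b) b * f (a + b).
Proof.
move=> fl; rewrite /capp /app (fsum_single (i0 := (a + b, 0))); last first.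
  move=> [i j] /scale_neq0[/boolr_neq0[/eqP/= ab _] /outer_neq0[_ /delta_neq0 j0]].
  by rewrite ab j0 addr0.
rewrite -[_ *: _]/(sub_add 1 (a + b, 0) (a, b) * (f (a + b) * lone F 0)) /lone eqxx mulr1.
by rewrite /sub_add /graded /= addr0 eqxx mul1r subr0.
Qed.

Lemma capp_sub_add_outerr g : capp (sub_add 1) (outer (@lone F) g) = outer (@lone F) g.
Proof.
apply/funext => -[a b].
rewrite /capp /app (fsum_single (i0 := (0, b))); last first.
  move=> [i j] /scale_neq0[+ /outer_neq0[/delta_neq0 i0 _]].
  by rewrite i0 sub_add0 /delta; case: eqVneq => // -[_ ->].
rewrite sub_add0 -[_ *: _]/(_ * (_ * _)) /outer /= /lone eqxx mul1r /delta xpair_eqE eqxx.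
by rewrite andbT.
Qed.

Lemma outer_split f g : laur f -> laur g ->
  outer f g = cmul (outer f (@lone F)) (outer (@lone F) g).
Proof.
move=> fl gl; rewrite outer_cmul//; do ?exact: laur_lone.
by rewrite cmul1 cmulC cmul1.
Qed.

(** The identity behind this is e^(x0 + x2) - 1 = e^x2 (e^x0 - 1) + (e^x2 - 1). The twists match
    because e^(m (x0 + x2)) e^(n x2) = e^(m x0) e^((m + n) x2). *)
Lemma capp_sub_add_sub_expm1 m n p :
  capp (sub_add 1) (sub_expm1 F m n p) = capp (sub_expm1_add F m n) (sub_add 1 p).
Proof.
have tS := @sub_add_tri1 F; have tG := @sub_expm1_tri1 F;
  have tH := @sub_expm1_add_tri1 F.
have sS (e : F) p' : ser12 (sub_add e p') by exact: (tri1_ser12 _ (tS e)).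
have sG m' n' p' : ser12 (sub_expm1 F m' n' p') by exact: (tri1_ser12 _ (tG m' n')).
have dS p' : ser12 (delta F p') by exact/laurent2_ser12/delta_laurent2.
have oS f g : laur f -> laur g -> ser12 (outer f g).
  by move=> fl gl; exact/laurent2_ser12/outer_laurent2.
have ll := laur_lone F.
have eqE i : capp (sub_add 1) (sub_expm1 F 0 0 (i, 0)) = capp (sub_expm1_add F 0 0) (sub_add 1 (i, 0)).
  have sub_expm10 : sub_expm1 F 0 0 (0, 0) = delta F 0.
    by rewrite /sub_expm1 /= exp_expm1_0l expm1_pow0 -delta_outer.
  have sub_expm1_add0 : sub_expm1_add F 0 0 (0, 0) = delta F 0.
    by rewrite /sub_expm1_add /= !addr0 exp_expm1_0l expm1_pow0 -delta_outer.
  move: i; apply: family2_eq.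
  - by move=> i; apply: capp_ser12.
  - by move=> i; apply: capp_ser12.
  - by rewrite sub_expm10 app_delta sub_add0.
  - by rewrite sub_add0 app_delta sub_expm1_add0.
  - have -> : sub_add 1 (1, 0) = (fun p => delta F (1, 0) p + delta F (0, 1) p).
      by apply/funext => -[a b]; rewrite sub_add1 mul1r.
    rewrite appD1s// !app_delta /sub_expm1 /sub_expm1_add /= !addr0 !add0r !exp_expm1_0l exp_expm1_0r expm1_pow0 expm1_pow1.
    apply/funext => -[a b]; rewrite capp_sub_add_outerl; last first.
      by rewrite -expm1_pow1; exact: laur_expm1_pow.
    rewrite /expx_sub1 mulrBr -!/(exp_ser F 1 _) binser_exp_ser /outer /= -!/(exp_ser F 1 _).
    (* The constant -1 contributes only at a = b = 0. *)
    rewrite (_ : binser 1 (a + b) b * lone F (a + b) = lone F a * lone F b);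
      first by ring.
    rewrite /lone; have [->|b0] := eqVneq b 0.
      rewrite addr0; case: eqVneq => [->|_]; last by rewrite mulr0 mul0r.
      by rewrite binser0 /lone eqxx.
    have [ab|_] := eqVneq (a + b) 0; last by rewrite !mulr0.
    by rewrite ab binser0 /lone (negPf b0) mul0r mulr0.
  - move=> i; rewrite pair_succ sub_expm1M.
    by rewrite (capp_cmul1 (tS _) (tS _) (sub_addM _)).
  - move=> i; rewrite pair_succ sub_addM.
    by rewrite (capp_cmul1 (tH _ _) (tH _ _) (sub_expm1_addM F _ _)).
case: p => i j.
(* The power of x1 is split off without twist; what remains is a power of x2 together with the
   twist. *)
have -> : sub_expm1 F m n (i, j) = cmul (sub_expm1 F 0 0 (i, 0)) (sub_expm1 F m n (0, j)).
  by rewrite -sub_expm1M -pair_split.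
rewrite (capp_cmul1 (tS _) (tS _) (sub_addM _))// eqE sub_add_split.
rewrite (capp_cmul1 (tH _ _) (tH _ _) (sub_expm1_addM F _ _))// app_delta; congr cmul.
rewrite /sub_expm1 /sub_expm1_add /= exp_expm1_0r addr0 outer_split;
  [|exact: laur_exp_ser|exact: laur_exp_expm1].
have -> : exp_expm1 F (m + n) j = cmul (exp_ser F m) (exp_expm1 F n j).
  by rewrite -exp_expm1_0r -exp_expm1D add0r.
rewrite (capp_cmul1 (tS _) (tS _) (sub_addM _)); last 2 first.
- by apply: oS => //; exact: laur_exp_ser.
- by apply: oS => //; exact: laur_exp_expm1.
rewrite capp_sub_add_outerr (_ : capp _ _ = outer (exp_ser F m) (exp_ser F m)).
  rewrite outer_cmul//; do ?[exact: laur_exp_ser|exact: laur_exp_expm1].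
  by rewrite [cmul _ (@lone F)]cmulC cmul1.
apply/funext => -[a b]; rewrite capp_sub_add_outerl ?binser_exp_ser//;
  exact: laur_exp_ser.
Qed.

(** At x0 = x2 (e^z - 1) the sum x2 + x0 is x2 e^z. By homogeneity this comes down to (1 + (e^z -
    1))^i = e^(i z). *)
Lemma capp_sub_scale_expm1_sub_addC m d p :
  capp (sub_scale_expm1 F m d) (sub_addC F p) = sub_exp F m d p.
Proof.
case: p => i j; apply/funext => -[a b]; rewrite /capp /app.
rewrite -(fsbig_widen ((fun t : int => (t, i + j - t)) @` setT))//; last first.
  move=> [r s] [_ /= nP]; apply/not_notP => /mul_neq0[_ /boolr_neq0[/= /eqP dE _]].
  by apply: nP; exists r => //; rewrite -dE addrK.
rewrite fsbig_image; last by move=> t t' _ _ [].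
transitivity (\sum_(t \in [set: int]) exp_expm1 F m t a * binser 1 i t * delta F (i + j + d) b).
  apply: eq_fsbigr => t _;
    rewrite -[_ *: _]/(_ * _) /sub_scale_expm1 /sub_addC /swap /graded /outer /=.
  set c := (_ == _); have -> : c = true by apply/eqP; exact: subrK.
  rewrite mul1r mulrAC; congr (_ * delta F _ b); congr (_ + d); exact: subrKC.
rewrite -mulr_fsuml /sub_exp /outer /=; congr (_ * _).
(* The remaining sum over the exponent of x0 is (1 + (e^x - 1))^i times e^(m x), evaluated by
   multiplicativity. *)
have := @capp_cmul F _ _ (exp_expm1 F m) (expm1_pow F) (binser 1 i) (delta F 0) a.
rewrite [cmul (binser 1 i) _]cmulC cmul1 app_delta binser_expm1_pow exp_expm1_0r -exp_serD [m + i]addrC => <- //.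
  by move=> p r; rewrite expm1_pow_mul_exp.
apply: (@finite_int3 (`|a|)) => -[[p q] r] /= [/binser_supp ? /delta_neq0 -> /expm1_pow_supp ?].
by move=> /exp_expm1_supp ?; box_lia.
Qed.

End KernelIdentities.

(** * Weak associativity and changes of variables, for abstract series *)

Section SeriesArguments.
Variable F : numFieldType.
Implicit Types (q : int * int -> F).

Section Arguments.
Variable W : lmodType F.
Implicit Types (P I A : int * int -> W).

Lemma convC q q' A : ser12 q -> ser12 q' -> ser12 A ->
  conv q (conv q' A) = conv q' (conv q A).
Proof. by move=> sq sq' sA; rewrite !convA1// cmulC. Qed.

Lemma convC21 q q' A : ser21 q -> ser21 q' -> ser21 A ->
  conv q (conv q' A) = conv q' (conv q A).
Proof. by move=> sq sq' sA; rewrite !convA2// cmulC. Qed.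

Lemma conv_deltaE (p : int * int) A : conv (delta F p) A = fun k => A (k - p).
Proof. by apply/funext => k; rewrite conv_delta. Qed.

Lemma conv_delta0 A : conv (delta F 0) A = A.
Proof. by rewrite conv_deltaE; apply/funext => k; rewrite subr0. Qed.

Lemma app_id (M : int * int -> int * int -> F) A :
  (forall p, M p = delta F p) -> app M A = A.
Proof.
move=> Md; apply/funext => k; rewrite /app (fsum_single (i0 := k)) ?Md /delta.
  by rewrite eqxx scale1r.
by move=> i; rewrite Md /delta; case: eqVneq => // _; rewrite scale0r.
Qed.

Lemma app_sub_add_inv (eps : F) A :
  ser12 A -> app (sub_add (- eps)) (app (sub_add eps) A) = A.
Proof.
move=> sA; rewrite (app_app1 (@sub_add_tri1 F _) (@sub_add_tri1 F _))//.
by apply: app_id => p; exact: sub_add_inv.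
Qed.

(** For i >= 0 the two expansions of (x0 + x2)^i are the same polynomial, by the symmetry of
    binomial coefficients. *)
Lemma sub_addC_pos (i j : int) : 0 <= i -> sub_addC F (i, j) = sub_add 1 (i, j).
Proof.
case: i => // i _; apply/funext => -[a b].
rewrite /sub_addC /sub_add /swap /graded /= [b + a]addrC.
case: eqP => [ab|]; last by rewrite !mul0r.
rewrite !mul1r /binser; case: a ab => [a|a] ab.
  case eqE : (b - j) => [k|k]; rewrite !expr1n !mul1r !binz_nat.
    have ai : (a <= i)%N by lia.
    by rewrite -bin_sub//; congr ('C(_, _)%:R); lia.
  by rewrite bin_small//; lia.
case eqE : (b - j) => [k|k] //; rewrite expr1n mul1r binz_nat bin_small//; lia.
Qed.

Lemma app_sub_addC_pos A : (forall a b : int, A (a, b) <> 0 -> 0 <= a) ->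
  app (sub_addC F) A = app (sub_add 1) A.
Proof.
move=> A0; apply/funext => k; apply: eq_fsbigr => -[i j] _.
have [i0|i0] := leP 0 i; first by rewrite sub_addC_pos.
have -> : A (i, j) = 0 by apply/not_notP => /A0; lia.
by rewrite !scaler0.
Qed.

Lemma sub_add_power2 (eps : F) (k : nat) : power2 (sub_add eps (k%:Z, 0)).
Proof. by move=> a b /sub_add_pos; apply. Qed.

End Arguments.

Section Arguments2.
Variable W : lmodType F.
Implicit Types (P I A : int * int -> W).

(** The exponent [l], which may vary with the vector acted upon, leaves the conclusion: the claim is
    first obtained for x1^l P and then divided by x1^l. *)
Lemma weak_assoc_subst (k l : nat) P I : ser12 P -> ser21 I ->
    (forall a b : int, I (a, b) <> 0 -> - k%:Z <= a) ->
    conv (sub_add 1 (l%:Z, 0)) (app (sub_add 1) P) = conv (sub_add 1 (l%:Z, 0)) I ->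
  laurent2 (conv (sub_add (-1) (k%:Z, 0)) P) /\
  app (sub_addC F) (conv (sub_add (-1) (k%:Z, 0)) P)
    = conv (capp (sub_addC F) (sub_add (-1) (k%:Z, 0))) I.
Proof.
move=> sP sI Ik; set pl := sub_add 1 (l%:Z, 0); set dk := sub_add (-1) (k%:Z, 0) => wa.
have tS := @sub_add_tri1 F; have tp := @sub_addC_tri3 F.
have pl12 : ser12 pl by exact/power2_ser12/sub_add_power2.
have pl21 : ser21 pl by exact/power2_ser21/sub_add_power2.
have dk12 : ser12 dk by exact/power2_ser12/sub_add_power2.
have d12 p : ser12 (delta F p) by exact/laurent2_ser12/delta_laurent2.
have d21 p : ser21 (delta F p) by exact/laurent2_ser21/delta_laurent2.
have sSP : ser12 (app (sub_add 1) P) by exact: app_ser12.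
(* [C] is (x0 + x2)^l I. Its two descriptions give it lower-bounded powers of x2, from [P], and of
   x0, from [I]. *)
pose C := conv pl I.
have CP : C = app (sub_add 1) (conv (delta F (l%:Z, 0)) P).
  by rewrite (app_conv1 (tS _) (tS _) (sub_addM _))// app_delta wa.
have C12 : ser12 C by rewrite -[C]wa; exact: conv_ser12.
have Ca (a b : int) : C (a, b) <> 0 -> - k%:Z <= a.
  by move=> h; have [p1 [p2 [/sub_add_power2[? ?] /Ik]]] := conv_neq0_2 h; lia.
pose C' := conv (delta F (k%:Z, 0)) C.
have C'12 : ser12 C' by exact: conv_ser12.
have C'E (a b : int) : C' (a, b) = C (a - k%:Z, b).
  by rewrite /C' conv_delta -[X in _ = C (_, X)]subr0.
have C'a (a b : int) : C' (a, b) <> 0 -> 0 <= a.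
  by rewrite C'E => /Ca; lia.
(* The substitution x0 = x1 - x2 in x0^k C, which has no negative powers of x0; the result has none
   of x1 and equals x1^l (x1 - x2)^k P. *)
pose Q := app (sub_add (-1)) C'.
have QP : Q = conv (delta F (l%:Z, 0)) (conv dk P).
  rewrite /Q /C' (app_conv1 (tS _) (tS _) (sub_addM _))// app_delta CP.
  rewrite app_sub_add_inv; last exact: conv_ser12.
  exact: convC.
have Qa (a b : int) : Q (a, b) <> 0 -> 0 <= a.
  by move=> h; have [[p1 p2] [/sub_add_pos h1 /C'a h2]] := app_neq0 h; case: h1.
have Ql : laurent2 Q.
  have [N [g Cg]] := C'12; exists (- `|N|) => a b h; have := Qa _ _ h.
  by have [[p1 p2] [/sub_add_tri1[? ?] /Cg[? _]]] := app_neq0 h; lia.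
have RQ : conv dk P = conv (delta F (- l%:Z, 0)) Q.
  rewrite QP convA1//; last exact: conv_ser12.
  rewrite -delta_add (_ : _ + _ = 0) ?conv_delta0//.
  by apply: injective_projections => /=; rewrite ?addNr ?addr0.
have Rl : laurent2 (conv dk P) by rewrite RQ; apply: conv_laurent2 => //;
  exact: delta_laurent2.
split=> //.
have pR : ser21 (app (sub_addC F) (conv dk P)) by exact: app_ser3 tp Rl.
(* Multiplied by (x0 + x2)^l, the left side is the image of [Q]. Both expansions of x0 + x2 agree on
   [Q], which has no negative powers of x1, and undoing x0 = x1 - x2 returns [C']. *)
have eR : conv pl (app (sub_addC F) (conv dk P)) = conv pl (conv (delta F (k%:Z, 0)) I).
  rewrite convC21// -[conv pl I]/C -/C'.
  have := @app_conv3 _ _ _ _ _ _ tp tp (@sub_addCM F) (delta_laurent2 F (l%:Z, 0)) Rl.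
  rewrite app_delta sub_addC_pos// -/pl => <-.
  rewrite -QP app_sub_addC_pos//.
  by have := @app_sub_add_inv W (-1) _ C'12; rewrite opprK.
have -> : capp (sub_addC F) dk = delta F (k%:Z, 0).
  rewrite -(sub_add_inv (-1) (k%:Z, 0)) opprK.
  by apply: (@app_sub_addC_pos F^o) => a b /sub_add_power2[].
(* The factor (x0 + x2)^l is cancelled by its inverse expanded in nonnegative powers of x0, a
   legitimate product in W((x2))((x0)). *)
have := congr1 (conv (sub_addC F (- l%:Z, 0))) eR.
have pN21 : ser21 (sub_addC F (- l%:Z, 0)).
  rewrite -(@app_delta F _ _ (sub_addC F)).
  by apply: capp_ser3 => //; exact: delta_laurent2.
have -> := convA2 pN21 pl21 pR.
have -> := convA2 pN21 pl21 (conv_ser21 (d21 (k%:Z, 0)) sI).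
have -> : cmul (sub_addC F (- l%:Z, 0)) pl = delta F 0.
  rewrite -[pl]sub_addC_pos// -sub_addCM (_ : _ + _ = (0, 0)) ?sub_addC_pos// ?sub_add0//.
  by apply: injective_projections => /=; rewrite ?addNr ?addr0.
by rewrite !conv_delta0.
Qed.

(** [P'] and [I'] are the series that [XW] and [Ybracket] attach to homogeneous vectors of weights
    [m] and [n]. *)
Lemma subst_compat_exp (m n : int) q P I : power2 q -> ser12 P -> ser21 I ->
    laurent2 (conv q P) -> app (sub_addC F) (conv q P) = conv (capp (sub_addC F) q) I ->
    let P' := conv (delta F (m, n)) P in
    let I' := app (sub_scale_expm1 F m (m + n)) I in
  laurent2 (conv q P') /\ app (sub_exp F 0 0) (conv q P') = conv (capp (sub_exp F 0 0) q) I'.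
Proof.
move=> q2 sP sI Rl e P' I'; have tp := @sub_addC_tri3 F;
  have tT := @sub_scale_expm1_tri2 F.
have q12 := power2_ser12 q2; have q21 := power2_ser21 q2; have ql := power2_laurent2 q2.
have d12 : ser12 (delta F (m, n)) by exact/laurent2_ser12/delta_laurent2.
have eqE : conv q P' = conv (delta F (m, n)) (conv q P) by rewrite convC.
rewrite eqE; split; first exact: conv_laurent2 (delta_laurent2 _ _) Rl.
(* The substitution x1 = x2 e^x0 is factored through x1 = x2 + x0, where the hypothesis applies. *)
transitivity (app (sub_scale_expm1 F m (m + n)) (app (sub_addC F) (conv q P)));
  last first.
  rewrite e (app_conv2 (tT _ _) (tT _ _) (sub_scale_expm1M F _ _))//; last first.
    exact: capp_ser3.
  have <- : (fun p => capp (sub_scale_expm1 F 0 0) (sub_addC F p)) = sub_exp F 0 0.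
    by apply/funext => p; exact: capp_sub_scale_expm1_sub_addC.
  congr conv; exact: (@app_app3 F F^o _ _ _ _ tp (tT _ _) ql).
(* The monomial x1^m x2^n becomes e^(m x0) x2^(m + n), which is the twist of [sub_scale_expm1]. *)
rewrite (app_app3 tp (tT _ _) Rl); apply/funext => k.
rewrite /app [LHS](reindex_fsbigT (fun p => p + (m, n))); last first.
  by exists (fun p => p - (m, n)) => p; rewrite ?addrK ?subrK.
apply: eq_fsbigr => -[i j] _; rewrite conv_delta addrK capp_sub_scale_expm1_sub_addC;
  congr (_ *: _).
rewrite /sub_exp; congr (outer (exp_ser F _) (delta F _) k) => /=; lia.
Qed.

Lemma weak_assoc_bracket (m n : int) (l : nat) P I : ser12 P -> ser21 I ->
    conv (sub_add 1 (l%:Z, 0)) (app (sub_add 1) P) = conv (sub_add 1 (l%:Z, 0)) I ->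
  conv (sub_add 1 (l%:Z, 0)) (app (sub_add 1) (app (sub_expm1 F m n) P))
    = conv (sub_add 1 (l%:Z, 0)) (app (sub_expm1_add F m n) I).
Proof.
move=> sP sI; set pl := sub_add 1 (l%:Z, 0) => wa.
have tS := @sub_add_tri1 F; have tG := @sub_expm1_tri1 F;
  have tH := @sub_expm1_add_tri1 F.
have tH2 := @sub_expm1_add_tri2 F.
have pl12 : ser12 pl by exact/power2_ser12/sub_add_power2.
have pl21 : ser21 pl by exact/power2_ser21/sub_add_power2.
have sSP : ser12 (app (sub_add 1) P) by exact: app_ser12.
have sGP : ser12 (app (sub_expm1 F m n) P) by exact: app_ser12.
(* With x = x0 + x2, [hl] is (e^x - 1)^l, [sN] its inverse, and [Gam] is (x / (e^x - 1))^l. *)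
pose hl := capp (sub_expm1_add F 0 0) pl.
pose sN := capp (sub_add 1) (sub_expm1 F 0 0 (- l%:Z, 0)).
pose Gam := cmul pl sN.
have hl2 : power2 hl.
  move=> a b h;
    have [[p1 p2] [/outer_neq0[/exp_expm1_supp/= ? /exp_expm1_supp/= ?] /sub_add_power2[? ?]]] := capp_neq0 h.
  by split; lia.
have hlE : hl = capp (sub_add 1) (sub_expm1 F 0 0 (l%:Z, 0)) by rewrite capp_sub_add_sub_expm1.
have G12 i : ser12 (sub_expm1 F 0 0 (i, 0)) by exact: tri1_ser12.
have sN12 : ser12 sN by exact: capp_ser12.
have d12 p : ser12 (delta F p) by exact/laurent2_ser12/delta_laurent2.
have hs : cmul sN hl = delta F 0.
  rewrite hlE -(capp_cmul1 (tS _) (tS _) (sub_addM _))// -sub_expm1M.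
  rewrite (_ : _ + _ = 0); last first.
    by apply: injective_projections => /=; rewrite ?addNr ?addr0.
  rewrite /sub_expm1 /= exp_expm1_0l expm1_pow0 (_ : outer _ _ = delta F 0) ?app_delta ?sub_add0//.
  by rewrite -[0 in RHS]/(0, 0) delta_outer.
(* [Gam] is the image under x1 = x0 + x2 of x1^l (e^x1 - 1)^(-l), which has no negative powers. *)
have Gam2 : power2 Gam.
  rewrite /Gam /pl -(app_delta (sub_add 1)) -(capp_cmul1 (tS _) (tS _) (sub_addM _))//.
  move=> a b h; have [[i j] [h1 h2]] := capp_neq0 h; move: h2.
  rewrite cmul_delta /sub_expm1 /= !exp_expm1_0l expm1_pow0 => /outer_neq0[/expm1_pow_supp /= ?].
  rewrite subr0 => /delta_neq0 /= j0; move: h1; rewrite j0 => /sub_add_pos[];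
    last by lia.
  by lia.
have Gam12 := power2_ser12 Gam2; have Gam21 := power2_ser21 Gam2.
have hl12 := power2_ser12 hl2; have hl21 := power2_ser21 hl2.
have Gamh : cmul Gam hl = pl.
  by rewrite /Gam -cmulA1// hs cmulC cmul_delta0.
have SG : app (sub_add 1) (app (sub_expm1 F m n) P) = app (sub_expm1_add F m n) (app (sub_add 1) P).
  rewrite (app_app1 (tG _ _) (tS _))// (app_app1 (tS _) (tH _ _))//.
  by congr app; apply/funext => p; exact: capp_sub_add_sub_expm1.
have sHS : ser12 (app (sub_expm1_add F m n) (app (sub_add 1) P)) by exact: app_ser12.
have sHI : ser21 (app (sub_expm1_add F m n) I) by apply: app_ser21 (tH2 _ _) sI.
(* Factoring [Gam] out leaves the weak associativity identity multiplied by [hl], the image of the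
   original factor. *)
rewrite SG -Gamh -convA1// -convA2//; congr (conv Gam).
rewrite /hl -(app_conv1 (tH _ _) (tH _ _) (sub_expm1_addM F _ _))// wa.
by rewrite (app_conv2 (tH2 _ _) (tH2 _ _) (sub_expm1_addM F _ _)).
Qed.

End Arguments2.
End SeriesArguments.

(** * Nonvanishing of products and of q(x2 e^x0, x2) *)

Section Nonvanishing.
Variable F : numFieldType.
Implicit Types (q : int * int -> F).

Lemma power2_lead q : power2 q -> q <> (fun=> 0) ->
  exists a b : int, q (a, b) <> 0 /\
    forall a' b' : int, q (a', b') <> 0 -> a < a' \/ a = a' /\ b <= b'.
Proof.
move=> q2 q0; have [[i j] qij] : exists p, q p <> 0.
  by apply/not_existsP => h; apply: q0; apply/funext => p; apply/not_notP/h.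
have exa : exists a : nat, `[< exists b : int, q (a%:Z, b) <> 0 >].
  have [? ?] := q2 _ _ qij; exists (absz i); apply/asboolP; exists j.
  by rewrite gez0_abs.
case: (ex_minnP exa) => a /asboolP[j0 qaj] amin.
have exb : exists b : nat, `[< q (a%:Z, b%:Z) <> 0 >].
  have [? ?] := q2 _ _ qaj; exists (absz j0); apply/asboolP.
  by rewrite gez0_abs.
case: (ex_minnP exb) => b /asboolP qab bmin.
exists a, b; split=> // a' b' q'; have [a0 b0] := q2 _ _ q'.
case: a' b' a0 b0 q' => // a' [] // b' _ _ q'.
have aa' : (a <= a')%N by apply: amin; apply/asboolP; exists b'.
have [aa'E|?] := eqVneq a a'; last by left; lia.
right; split; first by rewrite aa'E.
by apply: bmin; apply/asboolP; rewrite aa'E.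
Qed.

Lemma cmul_power2 q q' : power2 q -> power2 q' -> power2 (cmul q q').
Proof.
move=> q2 q'2 a b h.
by have [p1 [p2 [/q2[? ?] /q'2[? ?]]]] := @conv_neq0_2 F F^o _ _ _ _ h; lia.
Qed.

(** At the sum of the lexicographically least exponents, only the product of the two leading
    coefficients contributes. *)
Lemma cmul_power2_neq0 q q' : power2 q -> power2 q' -> q <> (fun=> 0) -> q' <> (fun=> 0) ->
  cmul q q' <> (fun=> 0).
Proof.
move=> q2 q'2 /(power2_lead q2)[a [b [qab qm]]] /(power2_lead q'2)[a' [b' [qab' qm']]].
move=> /(congr1 (fun f => f ((a + a' : int), (b + b' : int)))).
rewrite /cmul /conv (fsum_single (i0 := (a, b))).
  rewrite -[_ *: _]/(q (a, b) * q' (a + a' - a, b + b' - b)) [a + a' - a]addrAC.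
  rewrite [b + b' - b]addrAC !subrr !add0r => /eqP.
  by rewrite mulf_eq0 => /orP[] /eqP.
move=> [i j] /scale_neq0[/qm h1 h2].
have {}h2 := qm' (a + a' - i) (b + b' - j) h2.
by case: h1 h2 => [?|[-> ?]] [?|[? ?]]; try (congr pair); lia.
Qed.

(** The coefficient of x2^d is the sum of q(t, d - t) e^(t x0) over 0 <= t <= d, and exponentials
    with distinct t are linearly independent. *)
Lemma exp_subst_neq0 q : power2 q -> q <> (fun=> 0) ->
  capp (sub_exp F 0 0) q <> (fun=> 0).
Proof.
move=> q2 q0 e0; have [i [j [qij _]]] := power2_lead q2 q0.
have [i0 j0] := q2 _ _ qij.
case: i i0 qij => // i _ qij; case: j j0 qij => // j _ qij.
pose d := (i + j)%N.
have sumE (a : nat) : \sum_(t < d.+1) (t%:R ^+ a) * q (t%:Z, (d - t)%N%:Z) = 0.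
  have := congr1 (fun f => f (a%:Z, d%:Z)) e0.
  rewrite /capp /app /= (@fsum_fset _ _ ((fun t : nat => (t%:Z, d%:Z - t%:Z)) @` `I_d.+1)); last 2 first.
  - exact/finite_image/finite_II.
  - move=> [r s] /scale_neq0[/outer_neq0[_ /delta_neq0 /= dE] /q2[? ?]].
    by exists (absz r) => /=; [lia | congr pair; lia].
  rewrite -fsbig_finite; last exact/finite_image/finite_II.
  rewrite fsbig_image; last by move=> ? ? _ _ [].
  rewrite -(@fsbig_ord _ _ _ d.+1 (fun t : nat => sub_exp F 0 0 (t%:Z, d%:Z - t%:Z) (a%:Z, d%:Z) *:
     (q (t%:Z, d%:Z - t%:Z) : F^o))) => e1.
  apply: (mulIf (invr_neq0 (fact_neq0 F a))); rewrite mul0r -[RHS]e1 mulr_suml.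
  apply: eq_bigr => t _; rewrite -[_ *: _]/(_ * _) /sub_exp /outer /=.
  have -> : delta F (t%:Z + (d%:Z - t%:Z) + 0) d = 1.
    by rewrite addr0 subrKC /delta eqxx.
  have td : (t <= d)%N by rewrite -ltnS; exact: ltn_ord.
  rewrite mulr1 add0r -(subzn td).
  exact: mulrAC.
(* The power moments of the coefficients vanish, hence so does their pairing with any polynomial in
   t. *)
have polyE (r : {poly F}) : \sum_(t < d.+1) r.[t%:R] * q (t%:Z, (d - t)%N%:Z) = 0.
  under eq_bigr do rewrite horner_coef mulr_suml.
  rewrite exchange_big big1// => k _.
  under eq_bigr do rewrite -mulrA.
  by rewrite -mulr_sumr sumE mulr0.
have id : (i < d.+1)%N by rewrite /d; lia.
pose i' := Ordinal id.
(* An unnormalised Lagrange polynomial, vanishing at every node except [i]; it isolates q(i, j). *)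
pose r : {poly F} := \prod_(t < d.+1 | t != i') ('X - (t%:R)%:P).
have := polyE r.
rewrite (bigD1 i')//= big1 => [|t ti]; last first.
  rewrite /r horner_prod (bigD1 t)//= hornerXsubC subrr.
  by rewrite !mul0r.
rewrite addr0 (_ : (d - i)%N = j); last by rewrite /d; lia.
move/eqP; rewrite mulf_eq0 => /orP[|/eqP//].
rewrite /r horner_prod prodf_seq_eq0 => /hasP[t _ /andP[ti]].
rewrite hornerXsubC subr_eq0 eqr_nat => /eqP it.
by case/eqP: ti; apply: val_inj.
Qed.

Lemma sub_add_neq0 (eps : F) (k : nat) : sub_add eps (k%:Z, 0) <> (fun=> 0).
Proof.
move=> /(congr1 (fun f => f (k%:Z, 0))) /eqP.
by rewrite /sub_add /graded /= eqxx binz0 !mul1r oner_eq0.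
Qed.

End Nonvanishing.

(** * Translation between curried series and series indexed by pairs *)

Section Conversions.
Variable F : numFieldType.

(** Exponents taken as pairs form an additive group, to which [conv] and [app] apply. *)
Definition uncurry2 (T : Type) (A : int -> int -> T) : int * int -> T := fun p => A p.1 p.2.

Lemma uncurry2_inj (T : Type) (A B : int -> int -> T) :
  uncurry2 A = uncurry2 B -> A = B.
Proof.
by move=> e; apply/funext => a; apply/funext => b;
  apply: (congr1 (fun f => f (a, b)) e).
Qed.

Lemma uncurry2_mul2 (W : lmodType F) (q : int -> int -> F) (A : int -> int -> W) :
  uncurry2 (mul2 q A) = conv (uncurry2 q) (uncurry2 A).
Proof. by apply/funext => -[a b]. Qed.

Lemma pow_x0_x2E (m a c : int) : pow_x0_x2 F m a c = (a == m - c)%:R * binser 1 m c.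
Proof. by case: c => [k|k] /=; rewrite ?mulr0 ?expr1n ?mul1r. Qed.

Lemma uncurry2_subst_x0_x2 (W : lmodType F) (A : int -> int -> W) :
  uncurry2 (subst1 (@pow_x0_x2 F) A) = app (sub_add 1) (uncurry2 A).
Proof.
apply/funext => -[a b]; apply: eq_fsbigr => -[i j] _; congr (_ *: _).
rewrite pow_x0_x2E /sub_add /graded /=; congr (_%:R * _); congr nat_of_bool; lia.
Qed.

Lemma uncurry2_subst_x2_x0 (W : lmodType F) (A : int -> int -> W) :
  uncurry2 (subst1 (@pow_x2_x0 F) A) = app (sub_addC F) (uncurry2 A).
Proof.
apply/funext => -[a b]; apply: eq_fsbigr => -[i j] _; congr (_ *: _).
rewrite /pow_x2_x0 pow_x0_x2E /sub_addC /swap /graded /=.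
by congr (_%:R * _); congr nat_of_bool; lia.
Qed.

Lemma uncurry2_subst_exp (W : lmodType F) (A : int -> int -> W) :
  uncurry2 (subst1 (@pow_x2_exp_x0 F) A) = app (sub_exp F 0 0) (uncurry2 A).
Proof.
apply/funext => -[a b]; apply: eq_fsbigr => -[i j] _; congr (_ *: _).
rewrite /pow_x2_exp_x0 /sub_exp /outer /= add0r mulrC; congr (_ * _).
by rewrite /delta; congr (_%:R); congr nat_of_bool; lia.
Qed.

(** The parameter [eps] lets one binomial expansion serve both (x1 + x2)^k and (x1 - x2)^k. *)
Lemma poly2_sub_add (eps : F) (k : nat) :
  uncurry2 (poly2 (('X + eps%:P *: 'X%:P) ^+ k)) = sub_add eps (k%:Z, 0).
Proof.
apply/funext => -[a b]; rewrite /uncurry2 /=.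
have coefE (i j : nat) : (('X + eps%:P *: 'X%:P : {poly {poly F}}) ^+ k)`_i`_j
    = (i + j == k)%N%:R * (eps ^+ j * 'C(k, j)%:R).
  rewrite exprDn coef_sum.
  under eq_bigr => l _.
    rewrite -mul_polyC -polyCM -polyC_exp exprMn -polyC_exp.
    rewrite coefMn coefMC coefXn.
  over.
  rewrite coef_sum.
  under eq_bigr => l _.
    rewrite coefMn mulr_natl coefMn coefCM coefXn.
  over.
  have [ijk|ijk] := eqVneq (i + j)%N k.
    have jk : (j < k.+1)%N by lia.
    rewrite (bigD1 (Ordinal jk))//= big1 => [|l lj].
      rewrite eqxx (_ : i == (k - j)%N); last by apply/eqP; lia.
      by rewrite addr0 mulr1 mulr1n mul1r mulr_natr.
    rewrite (_ : (j == l) = false); last first.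
      by apply/negbTE; apply: contraNneq lj => jl; apply/eqP/val_inj.
    by rewrite mulr0 !mul0rn.
  rewrite mul0r big1// => l _; have [jl|_] := eqVneq j l; last by rewrite mulr0 !mul0rn.
  rewrite (_ : i == (k - l)%N = false) ?mulr0n ?mul0rn//.
  by apply/negbTE; apply: contraNneq ijk => il; rewrite il jl subnK// -ltnS.
rewrite /sub_add /graded /= addr0 subr0.
case: b => [j|j]; last by case: a => [i|i]; rewrite mulr0.
case: a => [i|i]; first by rewrite [LHS](coefE i j) /binser binz_nat -PoszD eqz_nat.
rewrite /binser binz_nat; case: eqP => [e|]; last by rewrite mul0r.
by rewrite bin_small ?mulr0//; lia.
Qed.

Lemma poly2_add (k : nat) :
  uncurry2 (poly2 (('X + 'X%:P) ^+ k)) = sub_add 1 (k%:Z, 0) :> (_ -> F).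
Proof. by rewrite -poly2_sub_add scale1r. Qed.

Lemma poly2_sub (k : nat) :
  uncurry2 (poly2 (('X - 'X%:P) ^+ k)) = sub_add (-1) (k%:Z, 0) :> (_ -> F).
Proof. by rewrite -poly2_sub_add polyCN scaleN1r. Qed.

Lemma is_laurent2P (W : lmodType F) (A : int -> int -> W) : is_laurent2 A <-> laurent2 (uncurry2 A).
Proof.
split=> -[N AN]; exists N => a b.
  move=> Aab; suff : ~~ ((a < N) || (b < N)) by rewrite negb_or -!leNgt => /andP[].
  by apply/negP => /AN.
by move=> abN; apply/not_notP => /AN[? ?]; move: abN; lia.
Qed.

Lemma is_power2P (W : lmodType F) (A : int -> int -> W) : is_power2 A <-> power2 (uncurry2 A).
Proof.
split=> AN a b.
  move=> Aab; suff : ~~ ((a < 0) || (b < 0)) by rewrite negb_or -!leNgt => /andP[].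
  by apply/negP => /AN.
by move=> abN; apply/not_notP => /AN[? ?]; move: abN; lia.
Qed.

End Conversions.

(** * Linear maps, infinite sums and gradings *)

Section LinearSums.
Variables (F : fieldType) (U W : lmodType F).
Implicit Type f : U -> W.

Definition lin f := forall (a : F) u v, f (a *: u + v) = a *: f u + f v.

Lemma lin0 f : lin f -> f 0 = 0.
Proof.
by move=> lf; have := lf (-1) 0 0; rewrite scaler0 addr0 scaleN1r addNr.
Qed.

Lemma linD f u v : lin f -> f (u + v) = f u + f v.
Proof. by move=> lf; rewrite -[u in LHS]scale1r lf scale1r. Qed.

Lemma linZ f a u : lin f -> f (a *: u) = a *: f u.
Proof. by move=> lf; rewrite -[_ *: _ in LHS]addr0 lf lin0// addr0. Qed.

Lemma lin_fsum (I : choiceType) f (g : I -> U) : lin f ->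
    finite_set [set i | g i <> 0] ->
  f (\sum_(i \in [set: I]) g i) = \sum_(i \in [set: I]) f (g i).
Proof.
move=> lf fin; rewrite (fsum_fset fin)// [RHS](fsum_fset fin); last first.
  by move=> i; apply: contra_not => ->; exact: lin0.
elim/big_rec2: _ => [|i y1 y2 _ <-]; first exact: lin0.
exact: linD.
Qed.

Lemma fsum_lin (I : choiceType) (f : I -> U -> W) :
    (forall i, lin (f i)) -> (forall u, finite_set [set i | f i u <> 0]) ->
  lin (fun u => \sum_(i \in [set: I]) f i u).
Proof.
move=> lf fin a u v; rewrite fsum_scaler -fsumD//.
  by apply: eq_fsbigr => i _; rewrite lf.
by apply: sub_finite_set (fin u) => i /scale_neq0[].
Qed.

Lemma linear_lin f : linear f <-> lin f.
Proof. by split=> lf a u v; exact: lf. Qed.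

Lemma lin_scale f (a : F) : lin f -> lin (fun u => a *: f u).
Proof. by move=> lf b u v; rewrite lf scalerDr !scalerA mulrC. Qed.

End LinearSums.

Section Gradings.
Variables (F : numFieldType) (V : lmodType F) (gr : int -> {pred V}).
Hypothesis grP : direct_sum_grading gr.

Local Notation hc := (homog_comp gr).

Lemma homog_compP v : homog_decomp gr v (hc v).
Proof.
have [c [cP _]] := grP.2 v.
exact: (@xgetI _ _ (homog_decomp gr v) c cP).
Qed.

Lemma homog_comp_uniq v c : homog_decomp gr v c -> hc v = c.
Proof.
move=> cP; have [c' [_ c'U]] := grP.2 v.
by rewrite -(c'U _ cP) -(c'U _ (homog_compP v)).
Qed.

Lemma gr0 n : 0 \in gr n. Proof. by case: (grP.1 n). Qed.

Lemma homog_comp_gr m v : v \in gr m -> hc v = fun n => if n == m then v else 0.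
Proof.
move=> vm; apply: homog_comp_uniq; split.
- by move=> n; case: eqVneq => [->//|_]; exact: gr0.
- by apply: sub_finite_set (finite_set1 m) => n /= /eqP; case: eqVneq.
- by rewrite (fsum_single (i0 := m)) ?eqxx// => n; case: eqVneq.
Qed.

Lemma homog_comp_finite v : finite_set [set n | hc v n <> 0].
Proof.
have [_ + _] := homog_compP v; apply: sub_finite_set => n /= /eqP.
by [].
Qed.

Lemma homog_comp_lin n : lin (fun v => hc v n).
Proof.
move=> a u v; pose c k := a *: hc u k + hc v k.
suff -> : hc (a *: u + v) = c by [].
apply: homog_comp_uniq.
have finu := homog_comp_finite u; have finv := homog_comp_finite v.
have [gu _ uE] := homog_compP u; have [gv _ vE] := homog_compP v.
have fina : finite_set [set n | a *: hc u n <> 0].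
  by apply: sub_finite_set finu => k /scale_neq0[].
split.
- by move=> k; have [_ ] := grP.1 k; apply; [exact: gu|exact: gv].
- have fuv : finite_set ([set n | hc u n <> 0] `|` [set n | hc v n <> 0]).
    by rewrite finite_setU.
  apply: sub_finite_set fuv => k /eqP ck;
    apply/not_notP => /not_orP[/contrapT u0 /contrapT v0].
  by apply: ck; rewrite /c u0 v0 scaler0 addr0.
- by rewrite /c fsumD// -fsum_scaler -uE -vE.
Qed.

(** Reduces additive statements to homogeneous vectors; the empty sum is covered because 0 is
    homogeneous. *)
Lemma homog_ind (P : V -> Prop) : (forall u v, P u -> P v -> P (u + v)) ->
  (forall m v, v \in gr m -> P v) -> forall v, P v.
Proof.
move=> PD Ph v; have [gv _ ->] := homog_compP v.
rewrite (fsum_fset (homog_comp_finite v))//.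
elim/big_ind: _ => [|//|n _]; first exact: (Ph 0 0 (gr0 0)).
exact: Ph (gv n).
Qed.

(** Both [exp_x_L0] and [XW] have this form: a weight-dependent linear map applied to each
    homogeneous component. *)
Lemma homog_sum_lin (W : lmodType F) (phi : int -> V -> W) :
    (forall n, lin (phi n)) -> lin (fun v => \sum_(n \in [set: int]) phi n (hc v n)).
Proof.
move=> lphi; apply: fsum_lin.
  by move=> n a u v; rewrite homog_comp_lin lphi.
move=> v; apply: sub_finite_set (homog_comp_finite v) => n.
by apply: contra_not => ->; exact: lin0.
Qed.

Lemma homog_sum_gr (W : lmodType F) (phi : int -> V -> W) m v :
    (forall n, lin (phi n)) -> v \in gr m ->
  \sum_(n \in [set: int]) phi n (hc v n) = phi m v.
Proof.
move=> lphi vm; rewrite (homog_comp_gr vm) (fsum_single (i0 := m)) ?eqxx//.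
by move=> n; case: eqVneq => // _; rewrite lin0.
Qed.

Lemma exp_x_L0_lin c : lin (fun v => exp_x_L0 gr v c).
Proof.
apply: (@homog_sum_lin V (fun n v => exp_coef F n c *: v)) => n.
by apply: lin_scale => a u v.
Qed.

Lemma exp_x_L0_gr m v c : v \in gr m -> exp_x_L0 gr v c = exp_ser F m c *: v.
Proof.
move=> vm; apply: (@homog_sum_gr V (fun n v => exp_coef F n c *: v)) => //.
by move=> n; apply: lin_scale => a u w.
Qed.

End Gradings.

(** * Vertex operator maps and the series they produce *)

Section IteratedLaurent.
Variables (F : numFieldType) (W : lmodType F).
Implicit Type A : int * int -> W.

(** Only finitely many rows lie between [k] and [M], so minus the sum of the absolute values of
    their bounds is a common lower bound. *)
Lemma ser12_rows A : (exists k : int, forall a b : int, A (a, b) <> 0 -> k <= b) ->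
    (forall b : int, exists N : int, forall a : int, A (a, b) <> 0 -> N <= a) ->
  ser12 A.
Proof.
move=> [k Ak] /choice[Nf NfP].
exists k, (fun M => - \sum_(i < (absz (M - k)).+1) `|Nf (k + i%:Z)|) => a b Aab.
have kb := Ak _ _ Aab; split=> // M bM.
have id : (absz (b - k)%R < (absz (M - k)%R).+1)%N by lia.
rewrite (bigD1 (Ordinal id))//=.
have -> : k + (absz (b - k)%R)%:Z = b by lia.
have := NfP _ _ Aab; set s := \sum_(_ < _ | _) _; have s0 : 0 <= s by exact: sumr_ge0.
lia.
Qed.

Lemma ser21_rows A : (exists k : int, forall a b : int, A (a, b) <> 0 -> k <= a) ->
    (forall a : int, exists N : int, forall b : int, A (a, b) <> 0 -> N <= b) ->
  ser21 A.
Proof.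
move=> [k Ak] AN; have [||l [g Ag]] := @ser12_rows (fun p => A (p.2, p.1)).
- by exists k => a b /Ak.
- by move=> b; have [N NP] := AN b; exists N => a /NP.
- by exists l, g => a b Aab; exact: (Ag b a Aab).
Qed.

End IteratedLaurent.

Section VertexMaps.
Variables (F : numFieldType) (V W : lmodType F).
Variables (Y : V -> V -> int -> V) (YW : V -> W -> int -> W).
Hypotheses (vY : vertex_map Y) (vYW : vertex_map YW).

Lemma vm_linl (w : W) n : lin (fun v => YW v w n).
Proof. exact/linear_lin/(vertex_map_linearl vYW). Qed.

Lemma vm_linr v n : lin (fun w => YW v w n).
Proof. exact/linear_lin/(vertex_map_linearr vYW). Qed.

Lemma vm_laur v w : exists N : int, forall n, YW v w n <> 0 -> N <= n.
Proof. exact/is_laurentP/(vertex_map_laurent vYW). Qed.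

Lemma vm_zerol w n : YW 0 w n = 0. Proof. exact: lin0 (vm_linl w n). Qed.
Lemma vm_zeror v n : YW v 0 n = 0. Proof. exact: lin0 (vm_linr v n). Qed.

Lemma op_prod_ser12 u v w : ser12 (uncurry2 (op_prod YW u v w)).
Proof.
apply: ser12_rows.
  have [N vN] := vm_laur v w; exists N => a b; rewrite /uncurry2 /op_prod /= => h.
  by apply: vN => vb; apply: h; rewrite vb vm_zeror.
by move=> b; have [N uN] := vm_laur u (YW v w b); exists N => a /uN.
Qed.

Lemma op_iter_ser21 u v w : ser21 (uncurry2 (op_iter Y YW u v w)).
Proof.
apply: ser21_rows.
  have [N uN] := (is_laurentP _).1 (vertex_map_laurent vY u v).
  exists N => a b; rewrite /uncurry2 /op_iter /= => h.
  by apply: uN => vb; apply: h; rewrite vb vm_zerol.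
by move=> a; have [N uN] := vm_laur (Y u v a) w; exists N => b /uN.
Qed.

Lemma op_prodDl u u' v w :
  uncurry2 (op_prod YW (u + u') v w) = fun p => uncurry2 (op_prod YW u v w) p + uncurry2 (op_prod YW u' v w) p.
Proof. by apply/funext => p; exact: (linD _ _ (vm_linl _ _)). Qed.

Lemma op_prodDr u v v' w :
  uncurry2 (op_prod YW u (v + v') w) = fun p => uncurry2 (op_prod YW u v w) p + uncurry2 (op_prod YW u v' w) p.
Proof.
apply/funext => p; rewrite /uncurry2 /op_prod (linD v v' (vm_linl _ _)).
exact: (linD _ _ (vm_linr _ _)).
Qed.

Lemma op_iterDl u u' v w :
  uncurry2 (op_iter Y YW (u + u') v w)
  = fun p => uncurry2 (op_iter Y YW u v w) p + uncurry2 (op_iter Y YW u' v w) p.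
Proof.
have lY := (linear_lin _).1 (vertex_map_linearl vY v _).
apply/funext => p; rewrite /uncurry2 /op_iter (linD u u' (lY _)).
exact: (linD _ _ (vm_linl _ _)).
Qed.

Lemma op_iterDr u v v' w :
  uncurry2 (op_iter Y YW u (v + v') w)
  = fun p => uncurry2 (op_iter Y YW u v w) p + uncurry2 (op_iter Y YW u v' w) p.
Proof.
have lY := (linear_lin _).1 (vertex_map_linearr vY u _).
apply/funext => p; rewrite /uncurry2 /op_iter (linD v v' (lY _)).
exact: (linD _ _ (vm_linl _ _)).
Qed.

Definition weak_assoc_at u v w (l : nat) :=
  conv (sub_add 1 (l%:Z, 0)) (app (sub_add 1) (uncurry2 (op_prod YW u v w)))
  = conv (sub_add 1 (l%:Z, 0)) (uncurry2 (op_iter Y YW u v w)).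

Lemma weak_assocP : weak_assoc Y YW <-> forall u v w, exists l, weak_assoc_at u v w l.
Proof.
split=> wa u v w; have [l h] := wa u v w; exists l.
  by move: h => /(congr1 (@uncurry2 _));
    rewrite !uncurry2_mul2 uncurry2_subst_x0_x2 poly2_add.
by apply: uncurry2_inj; rewrite !uncurry2_mul2 uncurry2_subst_x0_x2 poly2_add.
Qed.

Lemma weak_assoc_at_leq u v w l l' : weak_assoc_at u v w l -> weak_assoc_at u v w (l' + l).
Proof.
rewrite /weak_assoc_at => h.
have le : ((l' + l)%:Z, 0) = (l'%:Z, 0) + (l%:Z, 0) :> (int * int)%type.
  by apply: injective_projections => //=; rewrite addr0.
rewrite le sub_addM.
have p12 k : ser12 (sub_add (1 : F) (k%:Z, 0)) by exact/power2_ser12/sub_add_power2.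
have p21 k : ser21 (sub_add (1 : F) (k%:Z, 0)) by exact/power2_ser21/sub_add_power2.
have sP := op_prod_ser12 u v w; have sI := op_iter_ser21 u v w.
rewrite -(convA1 (p12 l') (p12 l)); last by apply: app_ser12 sP; exact: sub_add_tri1.
by rewrite -(convA2 (p21 l') (p21 l) sI) h.
Qed.

(** The two decompositions are hypotheses so as to cover additivity in [u] and in [v]; the exponents
    l1 and l2 are both raised to their sum. *)
Lemma weak_assoc_at_add (u v u1 v1 u2 v2 : V) w :
    uncurry2 (op_prod YW u v w) = (fun p => uncurry2 (op_prod YW u1 v1 w) p + uncurry2 (op_prod YW u2 v2 w) p) ->
    uncurry2 (op_iter Y YW u v w)
      = (fun p => uncurry2 (op_iter Y YW u1 v1 w) p + uncurry2 (op_iter Y YW u2 v2 w) p) ->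
  (exists l, weak_assoc_at u1 v1 w l) -> (exists l, weak_assoc_at u2 v2 w l) -> exists l, weak_assoc_at u v w l.
Proof.
move=> eP eI [l1 h1] [l2 h2]; exists (l1 + l2)%N; rewrite /weak_assoc_at eP eI.
have {}h2 := weak_assoc_at_leq l1 h2; have {h1} := weak_assoc_at_leq l2 h1.
rewrite addnC => h1; set pl := sub_add _ _.
have p12 : ser12 pl by exact/power2_ser12/sub_add_power2.
have p21 : ser21 pl by exact/power2_ser21/sub_add_power2.
have tS := @sub_add_tri1 F 1.
have sP u' v' := op_prod_ser12 u' v' w; have sI u' v' := op_iter_ser21 u' v' w.
rewrite (appD1 tS)// convD1//; do ?exact: app_ser12.
by rewrite convD2// h1 h2.
Qed.

Definition subst_compat_at (K : int * int -> int * int -> F) u v q :=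
  forall w, laurent2 (conv q (uncurry2 (op_prod YW u v w))) /\
    app K (conv q (uncurry2 (op_prod YW u v w)))
    = conv (capp K q) (uncurry2 (op_iter Y YW u v w)).

Lemma subst_compatP (k : int -> int -> int -> F) K q u v :
    (forall (U : lmodType F) (A : int -> int -> U), uncurry2 (subst1 k A) = app K (uncurry2 A)) ->
  subst_compat k Y YW q u v <-> subst_compat_at K u v (uncurry2 q).
Proof.
move=> kK.
have kq : uncurry2 (subst1 k (q : int -> int -> F^o) : int -> int -> F) = capp K (uncurry2 q).
  exact: (kK F^o).
split.
  move=> [h1 h2] w; split; first by have := (is_laurent2P _).1 (h1 w);
    rewrite uncurry2_mul2.
  by have := congr1 (@uncurry2 _) (h2 w); rewrite kK !uncurry2_mul2 kq.
move=> h; split=> w; have [h1 h2] := h w.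
  by apply/is_laurent2P; rewrite uncurry2_mul2.
by apply: uncurry2_inj; rewrite kK !uncurry2_mul2 kq.
Qed.

Lemma subst_compat_at_add K q (u v u1 v1 u2 v2 : V) : tri3 K -> power2 q ->
    (forall w, uncurry2 (op_prod YW u v w)
      = (fun p => uncurry2 (op_prod YW u1 v1 w) p + uncurry2 (op_prod YW u2 v2 w) p)) ->
    (forall w, uncurry2 (op_iter Y YW u v w)
      = (fun p => uncurry2 (op_iter Y YW u1 v1 w) p + uncurry2 (op_iter Y YW u2 v2 w) p)) ->
  subst_compat_at K u1 v1 q -> subst_compat_at K u2 v2 q -> subst_compat_at K u v q.
Proof.
move=> tK q2 eP eI h1 h2 w; have [l1 e1] := h1 w; have [l2 e2] := h2 w.
have sP u' v' := op_prod_ser12 u' v' w; have sI u' v' := op_iter_ser21 u' v' w.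
have sq := capp_ser3 tK (power2_laurent2 q2).
rewrite eP eI (convD1 (power2_ser12 q2))//; split; last first.
  by rewrite (appD3 tK)// convD2// e1 e2.
have [N1 h1'] := l1; have [N2 h2'] := l2; exists (- `|N1| - `|N2|) => a b h.
have [/h1'[? ?]|/h2'[? ?]] : conv q (uncurry2 (op_prod YW u1 v1 w)) (a, b) <> 0 \/
    conv q (uncurry2 (op_prod YW u2 v2 w)) (a, b) <> 0; try lia.
apply/not_notP => /not_orP[/contrapT h3 /contrapT h4]; apply: h.
by rewrite h3 h4 addr0.
Qed.

(** Lets two vectors with different factors [q] be given a common one before they are added. *)
Lemma subst_compat_at_mul K q q' u v :
  tri3 K -> (forall p r, K (p + r) = cmul (K p) (K r)) ->
  power2 q -> power2 q' -> subst_compat_at K u v q -> subst_compat_at K u v (cmul q' q).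
Proof.
move=> tK KM q2 q'2 h w; have [l e] := h w.
have sP := op_prod_ser12 u v w; have sI := op_iter_ser21 u v w.
have ql := power2_laurent2 q2; have q'l := power2_laurent2 q'2.
rewrite -(convA1 (power2_ser12 q'2) (power2_ser12 q2) sP); split;
  first exact: conv_laurent2.
rewrite (app_conv3 tK tK KM q'l l) e (capp_cmul3 tK tK KM)//.
by rewrite convA2//; exact: capp_ser3.
Qed.

End VertexMaps.

(** * The operators Y[v, x] and X_W(v, x) over a graded algebra *)

Section GradedAlgebra.
Variables (F : numFieldType) (V : lmodType F) (gr : int -> {pred V}).
Variables (Y : V -> V -> int -> V) (vac : V).
Hypothesis HV : nonlocal_vertex_Zgraded_algebra gr Y vac.

Let grP : direct_sum_grading gr := nvZa_grading HV.
Let vY : vertex_map Y := nva_vertex_map (nvZa_nva HV).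
Local Notation Ybr := (Ybracket gr Y).

Lemma Y_gr m n u v i : u \in gr m -> v \in gr n -> Y u v i \in gr (m + n + i).
Proof.
move=> um vn; have := nvZa_mode HV (- i - 1) um vn; rewrite /vmode.
rewrite (_ : - (- i - 1) - 1 = i); last by lia.
by rewrite (_ : m + n - (- i - 1) - 1 = m + n + i)//; lia.
Qed.

Lemma exp_x_L0_neq0 v c : exp_x_L0 gr v c <> 0 -> 0 <= c.
Proof. by move=> /fsum_neq0[n /scale_neq0[/exp_ser_supp]]. Qed.

(** The bound is uniform in [c] because all coefficients of e^(x L(0)) v lie in the span of the
    finitely many homogeneous components of [v]. *)
Lemma exp_x_L0_lower (W : lmodType F) (YW : V -> W -> int -> W) v w :
  vertex_map YW -> exists N : int, forall c j, YW (exp_x_L0 gr v c) w j <> 0 -> N <= j.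
Proof.
move=> vYW; elim/(homog_ind grP): v => [u v [N uN] [M vM]|m v vm].
  exists (- `|N| - `|M|) => c j; rewrite (linD u v (exp_x_L0_lin grP c)).
  rewrite (linD _ _ (vm_linl vYW _ _)) => h.
  have [/uN|/vM] : YW (exp_x_L0 gr u c) w j <> 0 \/ YW (exp_x_L0 gr v c) w j <> 0;
    try lia.
  apply/not_notP => /not_orP[/contrapT h3 /contrapT h4]; apply: h.
  by rewrite h3 h4 addr0.
have [N vN] := vm_laur vYW v w; exists N => c j.
by rewrite (exp_x_L0_gr grP _ vm) (linZ _ _ (vm_linl vYW _ _)) => /scale_neq0[_ /vN].
Qed.

Lemma Ybr_finite v w k : finite_set
  [set p : int * int | expm1_pow F p.2 (k - p.1) *: Y (exp_x_L0 gr v p.1) w p.2 <> 0].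
Proof.
have [N vN] := exp_x_L0_lower v w vY.
apply: (@finite_int2 (`|N| + `|k|)) => -[c j] /= /scale_neq0[/expm1_pow_supp ? h].
have := vN _ _ h; have : 0 <= c.
  by apply: (@exp_x_L0_neq0 v) => e; apply: h; rewrite e (vm_zerol vY).
by move=> ? ?; box_lia.
Qed.

Lemma Ybr_vertex_map : vertex_map Ybr.
Proof.
split.
- move=> w n; apply/linear_lin.
  apply: (@fsum_lin _ _ _ (int * int)%type
    (fun p v => expm1_pow F p.2 (n - p.1) *: Y (exp_x_L0 gr v p.1) w p.2)).
    move=> p; apply: lin_scale => a u v.
    by rewrite (exp_x_L0_lin grP p.1) (vm_linl vY).
  by move=> v; exact: Ybr_finite.
- move=> v n; apply/linear_lin.
  apply: (@fsum_lin _ _ _ (int * int)%type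
    (fun p w => expm1_pow F p.2 (n - p.1) *: Y (exp_x_L0 gr v p.1) w p.2)).
    by move=> p; apply: lin_scale; exact: vm_linr.
  by move=> w; exact: Ybr_finite.
- move=> v w; apply/is_laurentP; have [N vN] := exp_x_L0_lower v w vY.
  exists N => n /fsum_neq0[[c j] /scale_neq0[/expm1_pow_supp /= ? h]].
  have := vN _ _ h; have : 0 <= c; last by lia.
  by apply: (@exp_x_L0_neq0 v) => e; apply: h; rewrite e (vm_zerol vY).
Qed.

(** On a homogeneous vector the double sum collapses: summing over the powers of x in e^(m x) leaves
    e^(m x) (e^x - 1)^j. *)
Lemma Ybr_gr m u w k : u \in gr m ->
  Ybr u w k = \sum_(j \in [set: int]) exp_expm1 F m j k *: Y u w j.
Proof.
move=> um; have [N uN] := vm_laur vY u w.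
pose f (j c : int) := (exp_ser F m c * expm1_pow F j (k - c)) *: Y u w j.
have finf : finite_set [set p : int * int | f p.1 p.2 <> 0].
  apply: (@finite_int2 (`|N| + `|k|)) => -[j c] /=.
  by move=> /scale_neq0[/mul_neq0[/exp_ser_supp ? /expm1_pow_supp ?] /uN ?]; box_lia.
transitivity (\sum_(j \in [set: int]) \sum_(c \in [set: int]) f j c); last first.
  by apply: eq_fsbigr => j _; rewrite /exp_expm1 /cmul /conv fsum_scalel.
rewrite (fsum_pair finf) [RHS](reindex_fsbigT (fun p : int * int => (p.2, p.1))).
  apply: eq_fsbigr => -[c j] _ /=.
  by rewrite (exp_x_L0_gr grP _ um) (linZ _ _ (vm_linl vY _ _)) scalerA mulrC.
by exists (fun p : int * int => (p.2, p.1)) => -[].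
Qed.

Lemma Y_vac_neq0 v j : Y v vac j <> 0 -> 0 <= j.
Proof.
move=> h; rewrite leNgt; apply/negP => j0; apply: h.
exact: (nva_creation (nvZa_nva HV)).
Qed.

Lemma Ybr_vacuum v n : Ybr vac v n = if n == 0 then v else 0.
Proof.
rewrite (Ybr_gr _ _ (nvZa_vacuum HV)) (fsum_single (i0 := 0)).
  rewrite (nva_vacuum (nvZa_nva HV)) eqxx exp_expm1_0l expm1_pow0 /lone.
  by case: eqVneq; rewrite ?scale1r ?scale0r.
move=> i /scale_neq0[_]; rewrite (nva_vacuum (nvZa_nva HV)).
by case: eqVneq.
Qed.

Lemma Ybr_creation v n : n < 0 -> Ybr v vac n = 0.
Proof.
move=> n0; apply/not_notP => /fsum_neq0[[c j] /scale_neq0[/expm1_pow_supp /= ? h]].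
have := Y_vac_neq0 h; have : 0 <= c; last by lia.
by apply: (@exp_x_L0_neq0 v) => e; apply: h; rewrite e (vm_zerol vY).
Qed.

Lemma Ybr_creation_lim v : Ybr v vac 0 = v.
Proof.
elim/(homog_ind grP): v => [u v uE vE|m v vm].
  by rewrite (linD u v (vm_linl Ybr_vertex_map _ _)) uE vE.
rewrite (Ybr_gr _ _ vm) (fsum_single (i0 := 0)).
  rewrite (nva_creation_lim (nvZa_nva HV)) exp_expm1_0r.
  have -> : exp_ser F m 0 = 1 by rewrite -[X in exp_ser F m X]/(Posz 0) /exp_ser /exp_coef expr0 fact0 divr1.
  by rewrite scale1r.
by move=> i /scale_neq0[/exp_expm1_supp ? /Y_vac_neq0 ?]; lia.
Qed.

Section Module.
Variables (W : lmodType F) (YW : V -> W -> int -> W).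
Hypothesis vYW : vertex_map YW.
Local Notation X := (XW gr YW).

Lemma XW_lphi (w : W) k n : lin (fun v => YW v w (k - n)).
Proof. exact: vm_linl. Qed.

Lemma XW_gr m v w k : v \in gr m -> X v w k = YW v w (k - m).
Proof. by move=> vm; apply: (homog_sum_gr grP (XW_lphi w k) vm). Qed.

Lemma XW_vertex_map : vertex_map X.
Proof.
have lX w k : lin (fun v => X v w k).
  exact: (homog_sum_lin grP (XW_lphi w k)).
split.
- by move=> w n; apply/linear_lin; exact: lX.
- move=> v n; apply/linear_lin.
  apply: (@fsum_lin _ _ _ int (fun j w => YW (x_pow_L0 gr v j) w (n - j))).
    by move=> j; exact: vm_linr.
  move=> w; apply: sub_finite_set (homog_comp_finite grP v) => j /=.
  by apply: contra_not => e; rewrite /x_pow_L0 e (vm_zerol vYW).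
- move=> v w; apply/is_laurentP; elim/(homog_ind grP): v => [u v [N uN] [M vM]|m v vm].
    exists (- `|N| - `|M|) => n; rewrite (linD u v (lX _ _)) => h.
    have [/uN|/vM] : X u w n <> 0 \/ X v w n <> 0; try lia.
    apply/not_notP => /not_orP[/contrapT h3 /contrapT h4]; apply: h.
    by rewrite h3 h4 addr0.
  have [N vN] := vm_laur vYW v w; exists (N + m) => n.
  by rewrite (XW_gr _ _ vm) => /vN; lia.
Qed.

Lemma op_prod_XW m n u v w : u \in gr m -> v \in gr n ->
  uncurry2 (op_prod X u v w) = conv (delta F (m, n)) (uncurry2 (op_prod YW u v w)).
Proof.
move=> um vn; apply/funext => -[a b]; rewrite conv_delta /uncurry2 /op_prod /=.
by rewrite (XW_gr _ _ um) (XW_gr _ _ vn).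
Qed.

Lemma Ybr_finite_gr m u v a : finite_set [set i | exp_expm1 F m i a *: Y u v i <> 0].
Proof.
have [N uN] := vm_laur vY u v.
apply: (@finite_int (`|N| + `|a|)) => i /scale_neq0[/exp_expm1_supp ? /uN ?]; lia.
Qed.

(** The coefficient of Y(u, x0) v at x0^t has weight m + n + t; the resulting shift of x2 is that of
    x2^(m + n) combined with x0 = x2 (e^z - 1). *)
Lemma op_iter_XW m n u v w : u \in gr m -> v \in gr n ->
  uncurry2 (op_iter Ybr X u v w) = app (sub_scale_expm1 F m (m + n)) (uncurry2 (op_iter Y YW u v w)).
Proof.
move=> um vn; apply/funext => -[a b]; rewrite /uncurry2 /op_iter /= (Ybr_gr _ _ um).
rewrite (lin_fsum (vm_linl XW_vertex_map w b)); last exact: Ybr_finite_gr.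
rewrite /app -(fsbig_widen ((fun t : int => (t, b - (m + n + t))) @` setT))//;
  last first.
  move=> [i j] [_ /= nP];
    apply/not_notP => /scale_neq0[/outer_neq0[_ /delta_neq0 /= bE] _].
  by apply: nP; exists i => //; congr pair; lia.
rewrite fsbig_image; last by move=> t t' _ _ [].
apply: eq_fsbigr => t _ /=.
rewrite (linZ _ _ (vm_linl XW_vertex_map _ _)) (XW_gr _ _ (Y_gr _ um vn)).
congr (_ *: _);
  rewrite /sub_scale_expm1 /outer /= (_ : t + (b - (m + n + t)) + (m + n) = b);
  last by lia.
by rewrite /delta eqxx mulr1.
Qed.

End Module.

Lemma op_prod_Ybr m n u v w : u \in gr m -> v \in gr n ->
  uncurry2 (op_prod Ybr u v w) = app (sub_expm1 F m n) (uncurry2 (op_prod Y u v w)).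
Proof.
move=> um vn; apply/funext => -[a b]; rewrite /uncurry2 /op_prod /=.
rewrite (Ybr_gr _ _ um).
have [k [g Pg]] := op_prod_ser12 vY u v w.
pose f (i j : int) := (exp_expm1 F m i a * exp_expm1 F n j b) *: Y u (Y v w j) i.
have finf : finite_set [set p : int * int | f p.1 p.2 <> 0].
  apply: (@finite_int2 (`|a| + `|b| + `|k| + `|g b|)) => -[i j] /=.
  by move=> /scale_neq0[/mul_neq0[/exp_expm1_supp ? /exp_expm1_supp ?] /(Pg i j)[? /(_ b) ?]]; box_lia.
transitivity (\sum_(i \in [set: int]) \sum_(j \in [set: int]) f i j).
  apply: eq_fsbigr => i _; rewrite (Ybr_gr _ _ vn).
  rewrite (lin_fsum (vm_linr vY u i)); last exact: Ybr_finite_gr.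
  rewrite fsum_scaler; apply: eq_fsbigr => j _.
  by rewrite (linZ _ _ (vm_linr vY _ _)) scalerA.
by rewrite (fsum_pair finf).
Qed.

(** The coefficient of Y(u, x0) v at x0^i has weight m + n + i, whence the factor e^((m + n + i) x2)
    in [sub_expm1_add]. *)
Lemma op_iter_Ybr m n u v w : u \in gr m -> v \in gr n ->
  uncurry2 (op_iter Ybr Ybr u v w) = app (sub_expm1_add F m n) (uncurry2 (op_iter Y Y u v w)).
Proof.
move=> um vn; apply/funext => -[a b]; rewrite /uncurry2 /op_iter /=.
have [k [g Pg]] := op_iter_ser21 vY vY u v w.
pose f (i j : int) := (exp_expm1 F m i a * exp_expm1 F (m + n + i) j b) *: Y (Y u v i) w j.
have finf : finite_set [set p : int * int | f p.1 p.2 <> 0].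
  apply: (@finite_int2 (`|a| + `|b| + `|k| + `|g a|)) => -[i j] /=.
  by move=> /scale_neq0[/mul_neq0[/exp_expm1_supp ? /exp_expm1_supp ?] /(Pg i j)[? /(_ a) ?]]; box_lia.
transitivity (\sum_(i \in [set: int]) \sum_(j \in [set: int]) f i j).
  rewrite (Ybr_gr _ _ um) (lin_fsum (vm_linl Ybr_vertex_map w b));
    last exact: Ybr_finite_gr.
  apply: eq_fsbigr => i _; rewrite (linZ _ _ (vm_linl Ybr_vertex_map _ _)).
  rewrite (Ybr_gr _ _ (Y_gr _ um vn)) fsum_scaler.
  by apply: eq_fsbigr => j _; rewrite scalerA.
by rewrite (fsum_pair finf).
Qed.

Lemma Ybr_nonlocal_vertex_algebra : nonlocal_vertex_algebra Ybr vac.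
Proof.
have vB := Ybr_vertex_map.
split=> //; [exact: Ybr_vacuum|exact: Ybr_creation|exact: Ybr_creation_lim|].
apply/weak_assocP => u v w.
elim/(homog_ind grP): u => [u u' IHu IHu'|m u um].
  exact: (weak_assoc_at_add vB vB (op_prodDl vB _ _ _ _) (op_iterDl vB vB _ _ _ _) IHu IHu').
elim/(homog_ind grP): v => [v v' IHv IHv'|n v vn].
  exact: (weak_assoc_at_add vB vB (op_prodDr vB _ _ _ _) (op_iterDr vB vB _ _ _ _) IHv IHv').
have [l h] := (weak_assocP Y Y).1 (nva_weak_assoc (nvZa_nva HV)) u v w.
exists l; rewrite /weak_assoc_at (op_prod_Ybr _ um vn) (op_iter_Ybr _ um vn).
apply: weak_assoc_bracket h; [exact: op_prod_ser12|exact: op_iter_ser21].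
Qed.

(** * The phi-coordinated structures *)

Section PhiCoordinated.
Variables (W : lmodType F) (YW : V -> W -> int -> W).
Hypothesis vYW : vertex_map YW.
Hypothesis YW_vac : forall w n, YW vac w n = if n == 0 then w else 0.

(** One argument for modules and quasi modules: [Q] is the class of admissible factors, closed under
    products since the factors of two summands get multiplied. *)
Lemma XW_phi_coordinated (Q : (int * int -> F) -> Prop) :
    (forall q q', Q q -> Q q' -> Q (cmul q q')) ->
    (forall q, Q q -> power2 q /\ q <> (fun=> 0)) ->
    (forall u v, exists2 q, Q q & subst_compat_at Y YW (sub_addC F) u v q) ->
  is_phi_coordinated_for (fun q => Q (uncurry2 q)) Ybr vac (XW gr YW).
Proof.
move=> QM Q2 qm; have vX := XW_vertex_map vYW; have vB := Ybr_vertex_map.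
have tK := @sub_exp_tri3 F 0; have KM := @sub_expM F 0 0.
split=> //.
  by move=> w n; rewrite (XW_gr vYW _ _ (nvZa_vacuum HV)) subr0 YW_vac.
move=> u v;
  suff [q Qq h] : exists2 q, Q q & subst_compat_at Ybr (XW gr YW) (sub_exp F 0 0) u v q.
  have qE : uncurry2 (fun a b => q (a, b)) = q by apply/funext => -[].
  exists (fun a b => q (a, b)); rewrite qE; split=> //.
    move=> /(congr1 (@uncurry2 F)).
    rewrite -[LHS]/(uncurry2 (subst1 (@pow_x2_exp_x0 F) (fun a b => (q (a, b) : F^o)))).
    rewrite uncurry2_subst_exp; have [q2 q0] := Q2 _ Qq.
    have -> : uncurry2 (fun a b => (q (a, b) : F^o)) = q by exact: qE.
    exact: exp_subst_neq0.
  apply/(subst_compatP _ _ _ _ _ (@uncurry2_subst_exp F)); by rewrite qE.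
elim/(homog_ind grP): u => [u u' [q Qq IH] [q' Qq' IH']|m u um].
  have [q2 _] := Q2 _ Qq; have [q'2 _] := Q2 _ Qq'.
  exists (cmul q' q); first exact: QM.
  apply: (subst_compat_at_add vB vX tK _ (fun w => op_prodDl vX _ _ _ w)
    (fun w => op_iterDl vB vX _ _ _ w)).
  - exact: cmul_power2.
  - exact: subst_compat_at_mul.
  - by rewrite cmulC; exact: subst_compat_at_mul.
elim/(homog_ind grP): v => [v v' [q Qq IH] [q' Qq' IH']|n v vn].
  have [q2 _] := Q2 _ Qq; have [q'2 _] := Q2 _ Qq'.
  exists (cmul q' q); first exact: QM.
  apply: (subst_compat_at_add vB vX tK _ (fun w => op_prodDr vX _ _ _ w)
    (fun w => op_iterDr vB vX _ _ _ w)).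
  - exact: cmul_power2.
  - exact: subst_compat_at_mul.
  - by rewrite cmulC; exact: subst_compat_at_mul.
have [q Qq h] := qm u v; exists q => // w; have [q2 _] := Q2 _ Qq.
have [l e] := h w; rewrite (op_prod_XW vYW _ um vn) (op_iter_XW vYW _ um vn).
apply: subst_compat_exp e => //; [exact: op_prod_ser12|exact: op_iter_ser21].
Qed.

Lemma module_phi_coordinated : weak_assoc Y YW ->
  is_phi_coordinated_module Ybr vac (XW gr YW).
Proof.
move=> /weak_assocP wa.
have H : is_phi_coordinated_for
    (fun q => exists k : nat, uncurry2 q = sub_add (-1) (k%:Z, 0)) Ybr vac (XW gr YW).
  apply: (@XW_phi_coordinated (fun q => exists k : nat, q = sub_add (-1) (k%:Z, 0))).
  - move=> _ _ [k ->] [k' ->]; exists (k + k')%N.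
    have eqE : ((k + k')%:Z, 0) = (k%:Z, 0) + (k'%:Z, 0) :> (int * int)%type.
      by apply: injective_projections => //=; rewrite addr0.
    by rewrite eqE sub_addM.
  - by move=> _ [k ->]; split; [exact: sub_add_power2|exact: sub_add_neq0].
  move=> u v; have [N uN] := (is_laurentP _).1 (vertex_map_laurent vY u v).
  (* The pole order of Y(u, x0) v does not involve [w], so this power of x1 - x2 serves all [w]. *)
  exists (sub_add (-1) ((absz N)%:Z, 0)); first by exists (absz N).
  move=> w; have [l h] := wa u v w.
  apply: weak_assoc_subst h; [exact: op_prod_ser12|exact: op_iter_ser21|].
  move=> a b h; have : N <= a; last by lia.
  by apply: uN => ua; apply: h; rewrite /uncurry2 /op_iter /= ua (vm_zerol vYW).
split; [exact: phi_vertex_map H|exact: phi_vacuum H|].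
move=> u v; have [q [[k qE] q0 h]] := phi_assoc H u v; exists q; split=> //.
by exists k; apply: uncurry2_inj; rewrite poly2_sub.
Qed.

Lemma quasi_module_phi_coordinated :
  (forall u v, exists q : int -> int -> F,
    [/\ is_power2 (q : int -> int -> F^o), q <> (fun _ _ => 0)
      & subst_compat (@pow_x2_x0 F) Y YW q u v]) ->
  is_phi_coordinated_quasi_module Ybr vac (XW gr YW).
Proof.
move=> qm.
have H : is_phi_coordinated_for (fun q => power2 (uncurry2 q) /\ uncurry2 q <> (fun=> 0))
    Ybr vac (XW gr YW).
  apply: (@XW_phi_coordinated (fun q => power2 q /\ q <> (fun=> 0))) => //.
  - move=> q q' [q2 q0] [q'2 q'0]; split; first exact: cmul_power2.
    exact: cmul_power2_neq0.
  - move=> u v; have [q [/is_power2P q2 q0 h]] := qm u v.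
    exists (uncurry2 q);
      last by apply/(subst_compatP _ _ _ _ _ (@uncurry2_subst_x2_x0 F)).
    split=> // q0'; apply: q0; exact: (@uncurry2_inj _ q (fun _ _ => 0)).
split; [exact: phi_vertex_map H|exact: phi_vacuum H|].
move=> u v; have [q [[q2 _] q0 h]] := phi_assoc H u v; exists q; split=> //.
exact/is_power2P.
Qed.

End PhiCoordinated.
End GradedAlgebra.

Local Close Scope classical_set_scope.

Theorem proposition5p8 (R : realType) (V W : lmodType R[i])
    (gr : int -> {pred V}) (Y : V -> V -> int -> V) (vac : V)
    (YW : V -> W -> int -> W) :
  nonlocal_vertex_Zgraded_algebra gr Y vac ->
  nonlocal_vertex_algebra (Ybracket gr Y) vac /\
  (is_module Y vac YW ->
     is_phi_coordinated_module (Ybracket gr Y) vac (XW gr YW)) /\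
  (is_quasi_module Y vac YW ->
     is_phi_coordinated_quasi_module (Ybracket gr Y) vac (XW gr YW)).
Proof.
move=> HV; split; [|split].
- exact: (Ybr_nonlocal_vertex_algebra HV).
- by case=> vYW YWvac wa; exact: (module_phi_coordinated HV).
- by case=> vYW YWvac qm; exact: (quasi_module_phi_coordinated HV).
Qed.
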